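(* (Dirichlet Properties.) Let $\mathbf X={}^{T}(x_0,x_1,x_2)$ be a rationally independent triple of real numbers with $0<x_0<x_1<x_2$, and apply the Smallest Vector Algorithm to it. Then there exists an infinite set $S\subset\mathbb N$ such that the following hold. (a) We have $$\sup_{s\in S}\Bigl[\bigl(\max_{i=0,1,2}\|\mathbf g_i^{(s)\prime}\|\bigr)^2\bigl(\min_{i=0,1,2}\|\mathbf g_i^{(s)\prime\prime}\|\bigr)\Bigr]<+\infty,$$ and $\lim_{s\to+\infty,\ s\in S}\min_{i}\|\mathbf g_i^{(s)\prime\prime}\|=0$. (b) Suppose there exists $c>0$ such that $\|\mathbf h\|^2\|\mathbf h''\|>c$ for every nonzero integer vector $\mathbf h\in\mathbb Z^3$. Then, for the same set $S$, $$\sup_{s\in S}\Bigl[\bigl(\max_{i}\|\mathbf g_i^{(s)\prime}\|\bigr)^2\bigl(\max_{i}\|\mathbf g_i^{(s)\prime\prime}\|\bigr)\Bigr]<+\infty,$$ and $\lim_{s\to+\infty,\ s\in S}\max_i\|\mathbf g_i^{(s)\prime\prime}\|=0$. (c) Under the same hypothesis as in (b), for the same set $S$, $$\sup_{s\in S}\Bigl[\bigl(\max_{i}\|\mathbf b_i^{(s)\prime}\|\bigr)^2\bigl(\max_{i}\|\mathbf b_i^{(s)\prime\prime}\|\bigr)\Bigr]<+\infty,$$ and $\lim_{s\to+\infty,\ s\in S}\max_i\|\mathbf b_i^{(s)\prime}\|=0$.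
   Context: Use the Euclidean norm and inner product $\bullet$ on $\mathbb R^3$. Let $\mathbf X={}^{T}(x_0,x_1,x_2)$ with $0<x_0<x_1<x_2$. Set $\mathbb D=\mathbb R\mathbf X$ and $\mathbb P=\mathbb D^{\perp}$. For $\mathbf h\in\mathbb R^3$, write $\mathbf h'$ for its orthogonal projection on $\mathbb P$ and $\mathbf h''$ for its orthogonal projection on $\mathbb D$. The Smallest Vector Algorithm (SVA) produces integer $3\times3$ matrices $\mathbf G^{(s)}=(\mathbf g_0^{(s)},\mathbf g_1^{(s)},\mathbf g_2^{(s)})$, given by their columns, as follows. - $\mathbf G^{(0)}=\mathbf I$. - Given $\mathbf G^{(s)}$ (superscripts omitted), let $\Delta_{\min}=\min(\|\mathbf g_1'-\mathbf g_0'\|,\|\mathbf g_2'-\mathbf g_1'\|,\|\mathbf g_2'-\mathbf g_0'\|)$. Define $(\mathbf f_0,\mathbf f_1,\mathbf f_2)$ by: - $(\mathbf g_0,\mathbf g_1-\mathbf g_0,\mathbf g_2)$ if $\Delta_{\min}=\|\mathbf g_1'-\mathbf g_0'\|$; - $(\mathbf g_0,\mathbf g_1,\mathbf g_2-\mathbf g_1)$ if $\Delta_{\min}=\|\mathbf g_2'-\mathbf g_1'\|$; - $(\mathbf g_0,\mathbf g_1,\mathbf g_2-\mathbf g_0)$ if $\Delta_{\min}=\|\mathbf g_2'-\mathbf g_0'\|$. - $\mathbf G^{(s+1)}$ is any permutation of the columns $\mathbf f_0,\mathbf f_1,\mathbf f_2$ such that $\|\mathbf g_0^{(s+1)\prime\prime}\|\le\|\mathbf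 g_1^{(s+1)\prime\prime}\|\le\|\mathbf g_2^{(s+1)\prime\prime}\|$. $\mathbf B^{(s)}=({}^{T}\mathbf G^{(s)})^{-1}$ is the polar matrix of $\mathbf G^{(s)}$, with columns $\mathbf b_0^{(s)},\mathbf b_1^{(s)},\mathbf b_2^{(s)}$. *)

(* Defs.v *)
From HB Require Import structures.
From mathcomp Require Import all_boot all_order all_algebra all_fingroup.
From mathcomp Require Import all_classical all_reals all_analysis.
Set Implicit Arguments.
Unset Strict Implicit.
Unset Printing Implicit Defensive.
Import Order.TTheory GRing.Theory Num.Theory.
Local Open Scope ring_scope.

Definition dot (R : realType) (u v : 'cV[R]_3) : R :=
  \sum_(i < 3) u i 0 * v i 0.

(* The normedtype norm `|v| on matrices is the sup norm, so the Euclidean norm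
   is defined separately. *)
Definition enorm (R : realType) (v : 'cV[R]_3) : R := Num.sqrt (dot v v).

Definition lineOf (R : realType) (X h : 'cV[R]_3) : Prop :=
  exists a : R, h = a *: X.

Definition orthOf (R : realType) (X h : 'cV[R]_3) : Prop :=
  forall d : 'cV[R]_3, lineOf X d -> dot h d = 0.

(* h'' *)
Definition projD (R : realType) (X h : 'cV[R]_3) : 'cV[R]_3 :=
  (dot h X / dot X X) *: X.

(* h' *)
Definition projP (R : realType) (X h : 'cV[R]_3) : 'cV[R]_3 :=
  h - projD X h.

Lemma dotBl (R : realType) (u v w : 'cV[R]_3) :
  dot (u - v) w = dot u w - dot v w.
Proof.
by rewrite /dot -sumrB; apply: eq_bigr => i _; rewrite !mxE mulrBl.
Qed.

Lemma dotZl (R : realType) (a : R) (u v : 'cV[R]_3) :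
  dot (a *: u) v = a * dot u v.
Proof.
by rewrite /dot mulr_sumr; apply: eq_bigr => i _; rewrite mxE mulrA.
Qed.

Lemma dotC (R : realType) (u v : 'cV[R]_3) : dot u v = dot v u.
Proof. by apply: eq_bigr => i _; rewrite mulrC. Qed.

Lemma dotXX_neq0 (R : realType) (X : 'cV[R]_3) : X != 0 -> dot X X != 0.
Proof.
apply: contraNneq => X0; apply/eqP/colP => i; rewrite mxE.
have /(_ i isT)/eqP := psumr_eq0P (fun j _ => sqr_ge0 (X j 0)) X0.
by rewrite mulf_eq0 orbb => /eqP.
Qed.

(* projD and projP are the two components of h in the orthogonal
   decomposition R^3 = D (+) P. *)
Lemma proj_decomp (R : realType) (X h : 'cV[R]_3) : X != 0 ->
  [/\ lineOf X (projD X h), orthOf X (projP X h) & h = projP X h + projD X h].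
Proof.
move=> /dotXX_neq0 X0; split; [by exists (dot h X / dot X X) | | by rewrite subrK].
move=> _ [a ->]; rewrite dotC dotZl dotC /projP dotBl dotZl divfK //.
by rewrite subrr mulr0.
Qed.

Definition max3 (R : realType) (f : 'I_3 -> R) : R :=
  Num.max (f 0) (Num.max (f 1) (f 2)).

Definition min3 (R : realType) (f : 'I_3 -> R) : R :=
  Num.min (f 0) (Num.min (f 1) (f 2)).

Definition rationally_independent (R : realType) (X : 'cV[R]_3) : Prop :=
  forall q : 'I_3 -> rat,
    \sum_(i < 3) ratr (q i) * X i 0 = 0 -> forall i, q i = 0.

Definition toR (R : realType) m n (A : 'M[int]_(m, n)) : 'M[R]_(m, n) :=
  map_mx (fun z : int => z%:~R) A.

Definition gcol (R : realType) (G : 'M[int]_3) (i : 'I_3) : 'cV[R]_3 :=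
  col i (toR R G).

(* The columns of the polar matrix (G^T)^-1, computed over R. *)
Definition bcol (R : realType) (G : 'M[int]_3) (i : 'I_3) : 'cV[R]_3 :=
  col i (invmx (toR R G)^T).

(* || g_j' - g_i' || *)
Definition gapP (R : realType) (X : 'cV[R]_3) (G : 'M[int]_3) (i j : 'I_3) : R :=
  enorm (projP X (gcol R G j) - projP X (gcol R G i)).

Definition Delta_min (R : realType) (X : 'cV[R]_3) (G : 'M[int]_3) : R :=
  Num.min (gapP X G 0 1) (Num.min (gapP X G 1 2) (gapP X G 0 2)).

(* G with its column j replaced by g_j - g_i. *)
Definition subcol (G : 'M[int]_3) (i j : 'I_3) : 'M[int]_3 :=
  \matrix_(k, l) (if l == j then G k j - G k i else G k l).

(* When the minimum is attained several times, any of the corresponding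
   subtractions may be performed. *)
Definition sva_sub (R : realType) (X : 'cV[R]_3) (G F : 'M[int]_3) : Prop :=
  [\/ Delta_min X G = gapP X G 0 1 /\ F = subcol G 0 1,
      Delta_min X G = gapP X G 1 2 /\ F = subcol G 1 2 |
      Delta_min X G = gapP X G 0 2 /\ F = subcol G 0 2].

Definition sva_sorted (R : realType) (X : 'cV[R]_3) (G : 'M[int]_3) : Prop :=
  enorm (projD X (gcol R G 0)) <= enorm (projD X (gcol R G 1))
    <= enorm (projD X (gcol R G 2)).

Definition sva_step (R : realType) (X : 'cV[R]_3) (G G' : 'M[int]_3) : Prop :=
  exists F : 'M[int]_3, sva_sub X G F /\
    (exists p : 'S_3, G' = col_perm p F) /\ sva_sorted X G'.

Definition sva_run (R : realType) (X : 'cV[R]_3) (G : nat -> 'M[int]_3) : Prop :=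
  G 0%N = 1%:M /\ forall s, sva_step X (G s) (G s.+1).

Definition badly_approximable (R : realType) (X : 'cV[R]_3) : Prop :=
  exists2 c : R, 0 < c &
    forall h : 'cV[int]_3, h != 0 ->
      c < enorm (toR R h) ^+ 2 * enorm (projD X (toR R h)).

(* Main.v *)
Require Import Defs.
From HB Require Import structures.
From mathcomp Require Import all_boot all_order all_algebra all_fingroup.
From mathcomp Require Import all_classical all_reals all_analysis.
From mathcomp Require Import ring lra.
Set Implicit Arguments.
Unset Strict Implicit.
Unset Printing Implicit Defensive.
Import Order.TTheory GRing.Theory Num.Theory.
Import numFieldNormedType.Exports.
Local Open Scope classical_set_scope.
Local Open Scope ring_scope.

(**
Write [z_i > 0] for the coordinate of [g_i] along [X], [u_i] for its projection on the
plane orthogonal to [X], [M = max |u_i|], and [A] for the sum of the areas [|u_i x u_j|].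
The origin stays inside the triangle [u_0 u_1 u_2] and the determinant is [1], so that
[z_0 |u_1 x u_2| + z_1 |u_2 x u_0| + z_2 |u_0 x u_1| = 1]. A step [g_j -> g_j - g_i]
increases [A] by [|u_i x u_k|], and creates a vector whose length is the shortest side of
the triangle.

The set [S] consists of the times at which the triangle is thick: [M^2 <= 100 A]. If [S]
were finite, [M^2 - 10 A] would eventually not exceed its value one or two steps earlier,
because in a flat triangle [M] grows only at the expense of a larger growth of [A]; hence
[M] would be bounded infinitely often. This is impossible, since then only finitely many
integer matrices could occur while [z_0 + z_1 + z_2] strictly decreases.

On [S] one has [M^2 z_0 <= 100 A z_0 <= 100], which is (a). If [X] is badly approximable,
then [M = O(|u_0|)], so [|u_1 x u_2| |u_0| <= M (|u_2 x u_0| + |u_0 x u_1|)] gives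
[z_1 = O(M^-2)]; Dirichlet's theorem applied in the lattice of [g_0] and [g_1] then gives
[M^2 = O(|u_0 x u_1|)], whence [z_2 = O(M^-2)], which is (b). Cramer's rule gives (c).
*)

(** * Planar triangles *)

Lemma le_of_sqr (R : realFieldType) (x y : R) : 0 <= y -> x ^+ 2 <= y ^+ 2 -> x <= y.
Proof.
move=> y0 xy; case: (lerP x 0) => [/le_trans|x0]; first exact.
by rewrite -(ler_pXn2r (n := 2)) ?nnegrE // ltW.
Qed.

Lemma abs_le_of_sqr (R : realFieldType) (x y : R) :
  0 <= y -> x ^+ 2 <= y ^+ 2 -> `|x| <= y.
Proof. by move=> y0 xy; apply: le_of_sqr; rewrite ?real_normK ?num_real. Qed.

(** Lagrange's identity. Norms enter as numbers [a], [b] with prescribed squares, which keeps all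
    inequalities polynomial. *)
Lemma cross_sqr (R : realFieldType) (p1 q1 p2 q2 a b : R) :
  a ^+ 2 = p1 ^+ 2 + q1 ^+ 2 -> b ^+ 2 = p2 ^+ 2 + q2 ^+ 2 ->
  (p1 * q2 - p2 * q1) ^+ 2 = (a * b) ^+ 2 - (p1 * p2 + q1 * q2) ^+ 2.
Proof. by move=> ha hb; rewrite exprMn ha hb; ring. Qed.

Lemma dot_le_norms (R : realFieldType) (p1 q1 p2 q2 a b : R) :
  0 <= a -> 0 <= b ->
  a ^+ 2 = p1 ^+ 2 + q1 ^+ 2 -> b ^+ 2 = p2 ^+ 2 + q2 ^+ 2 ->
  `|p1 * p2 + q1 * q2| <= a * b.
Proof.
move=> a0 b0 ha hb; apply: abs_le_of_sqr; first exact: mulr_ge0.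
have := cross_sqr ha hb.
by have := sqr_ge0 (p1 * q2 - p2 * q1); lra.
Qed.

Lemma cross_le_norms (R : realFieldType) (p1 q1 p2 q2 a b : R) :
  0 <= a -> 0 <= b ->
  a ^+ 2 = p1 ^+ 2 + q1 ^+ 2 -> b ^+ 2 = p2 ^+ 2 + q2 ^+ 2 ->
  `|p1 * q2 - p2 * q1| <= a * b.
Proof.
move=> a0 b0 ha hb; apply: abs_le_of_sqr; first exact: mulr_ge0.
have := cross_sqr ha hb.
by have := sqr_ge0 (p1 * p2 + q1 * q2); lra.
Qed.

Lemma long_if_far (R : realFieldType) (p1 q1 p2 q2 a b M : R) :
  0 <= a -> 0 <= b ->
  a ^+ 2 = p1 ^+ 2 + q1 ^+ 2 -> b ^+ 2 = p2 ^+ 2 + q2 ^+ 2 ->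
  M ^+ 2 < (p1 - p2) ^+ 2 + (q1 - q2) ^+ 2 -> M < a + b.
Proof.
move=> a0 b0 ha hb hM; rewrite ltNge; apply/negP => hab.
have := dot_le_norms a0 b0 ha hb; rewrite ler_norml => /andP[h1 h2].
have : (a + b) ^+ 2 <= M ^+ 2 by rewrite ler_pXn2r ?nnegrE //; lra.
have -> : (a + b) ^+ 2 = p1 ^+ 2 + q1 ^+ 2 + (p2 ^+ 2 + q2 ^+ 2) + 2 * (a * b).
  by rewrite -ha -hb; ring.
nra.
Qed.

(** The small area forces the cosine to be at least 9/10 in absolute value, by Lagrange's identity.
    It is negative because the inner product is at most [(a^2 + b^2 - M^2) / 2 <= min(a, b)^2 / 2 <=
    a b / 2]. *)
Lemma dot_very_negative (R : realFieldType) (p1 q1 p2 q2 a b M : R) :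
  0 < M -> 0 <= a <= M -> 0 <= b <= M ->
  a ^+ 2 = p1 ^+ 2 + q1 ^+ 2 -> b ^+ 2 = p2 ^+ 2 + q2 ^+ 2 ->
  M ^+ 2 < (p1 - p2) ^+ 2 + (q1 - q2) ^+ 2 ->
  M / 2 <= a -> M / 2 <= b ->
  `|p1 * q2 - p2 * q1| <= M ^+ 2 / 100 ->
  p1 * p2 + q1 * q2 <= - (9 / 10 * (a * b)).
Proof.
move=> M0 /andP[a0 aM] /andP[b0 bM] ha hb hM Ma Mb hg.
have hx := cross_sqr ha hb.
set x := p1 * p2 + q1 * q2 in hx *; set g := p1 * q2 - p2 * q1 in hg hx.
have hab : M ^+ 2 / 4 <= a * b by nra.
have ab0 : 0 < a * b by apply: lt_le_trans hab; rewrite divr_gt0 // exprn_gt0.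
have hg2 : g ^+ 2 <= (4 / 100 * (a * b)) ^+ 2.
  rewrite -(real_normK (num_real g)) ler_pXn2r ?nnegrE //; nra.
have hx2 : (9 / 10 * (a * b)) ^+ 2 <= x ^+ 2 by rewrite !exprMn in hg2 hx *; nra.
have xle : x <= a * b / 2.
  have x2 : 2 * x < a ^+ 2 + b ^+ 2 - M ^+ 2 by rewrite ha hb /x; lra.
  case: (lerP a b) => h; nra.
rewrite lerNr; case: (lerP 0 x) => h0.
  have : x ^+ 2 <= (a * b / 2) ^+ 2 by rewrite ler_pXn2r ?nnegrE //; nra.
  nra.
by apply: le_of_sqr; rewrite ?sqrrN // oppr_ge0 ltW.
Qed.

(** Let [u], [v], [w] be the three vectors in order. The long sides give [u.w, v.w <= c^2 / 2], and
    [|u|^2 (v.w) = (u.v)(u.w) + (u x v)(u x w)] bounds [v.w] from below. So the cosine of [v] and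
    [w] is at most 6/10 in absolute value and the sine at least 8/10; finally [b >= M / 2]. *)
Lemma area_with_short_vector (R : realFieldType) (p1 q1 p2 q2 p3 q3 a b c M : R) :
  0 < M -> 0 <= a <= M -> 0 <= b <= M -> 0 <= c -> c <= a -> c <= b ->
  a ^+ 2 = p1 ^+ 2 + q1 ^+ 2 -> b ^+ 2 = p2 ^+ 2 + q2 ^+ 2 ->
  c ^+ 2 = p3 ^+ 2 + q3 ^+ 2 ->
  M ^+ 2 < (p2 - p3) ^+ 2 + (q2 - q3) ^+ 2 ->
  M ^+ 2 < (p1 - p3) ^+ 2 + (q1 - q3) ^+ 2 ->
  M / 2 <= a -> M / 2 <= b ->
  `|p1 * q2 - p2 * q1| <= M ^+ 2 / 100 ->
  p1 * p2 + q1 * q2 <= 0 ->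
  4 / 10 * (M * c) <= `|p2 * q3 - p3 * q2|.
Proof.
move=> M0 /andP[a0 aM] /andP[b0 bM] c0 ca cb ha hb hc h23 h13 Ma Mb hg hx0.
have hab : M ^+ 2 / 4 <= a * b by nra.
have a1 : 0 < a by nra.
have hbeta := cross_le_norms a0 c0 ha hc.
have hx := dot_le_norms a0 b0 ha hb.
have key : a ^+ 2 * (p2 * p3 + q2 * q3) =
  (p1 * p2 + q1 * q2) * (p1 * p3 + q1 * q3)
  + (p1 * q2 - p2 * q1) * (p1 * q3 - p3 * q1) by rewrite ha; ring.
have hal := cross_sqr hb hc.
set x := p1 * p2 + q1 * q2 in hx hx0 key.
set t := p1 * p3 + q1 * q3 in key.
set y := p2 * p3 + q2 * q3 in key hal.
set g := p1 * q2 - p2 * q1 in hg key.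
set be := p1 * q3 - p3 * q1 in hbeta key.
have ht : t <= c ^+ 2 / 2 by rewrite hc /t; have : a ^+ 2 <= M ^+ 2 by [nra]; rewrite ha; lra.
have hy : y <= c ^+ 2 / 2 by rewrite hc /y; have : b ^+ 2 <= M ^+ 2 by [nra]; rewrite hb; lra.
have hgb : `|g * be| <= 4 / 100 * (a * b) * (a * c).
  rewrite normrM; apply: ler_pM => //; lra.
have hylow : - (6 / 10 * (b * c)) <= y.
  have a2 : 0 < a ^+ 2 by rewrite exprn_gt0.
  rewrite -(ler_pM2l a2) key.
  have h1 : - (a * b) * (c ^+ 2 / 2) <= x * t.
    move: hx; rewrite ler_norml => /andP[hx _].
    apply: (@le_trans _ _ (x * (c ^+ 2 / 2))); first by rewrite ler_wpM2r // divr_ge0 ?sqr_ge0.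
    by rewrite ler_wnM2l.
  have h2 : a * b * (c ^+ 2) <= a ^+ 2 * b * c.
    have -> : a * b * c ^+ 2 = a * b * c * c by ring.
    have -> : a ^+ 2 * b * c = a * b * c * a by ring.
    by rewrite ler_wpM2l // !mulr_ge0.
  move: hgb; rewrite ler_norml => /andP[hgb _].
  have h0 : 0 <= a ^+ 2 * b * c by rewrite !mulr_ge0 // ltW.
  lra.
have hyup : y <= 6 / 10 * (b * c) by nra.
have hy2 : y ^+ 2 <= (6 / 10 * (b * c)) ^+ 2.
  rewrite -(real_normK (num_real y)) ler_pXn2r ?nnegrE //; first by rewrite ler_norml hylow hyup.
  by rewrite mulr_ge0 ?mulr_ge0 //; lra.
have bc0 : 0 <= b * c by apply: mulr_ge0.
have : 8 / 10 * (b * c) <= `|p2 * q3 - p3 * q2|.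
  apply: le_of_sqr => //; rewrite real_normK ?num_real // hal.
  rewrite !exprMn in hy2 *; lra.
nra.
Qed.

(* In a flat triangle all of whose sides are longer than the vectors [u = (p1, q1)],
   [v = (p2, q2)], [w = (p3, q3)] with [w] the shortest, [u] and [v] are almost opposite
   and [w] is short and far from parallel to them. *)
Lemma flat_triangle_shape (R : realFieldType) (p1 q1 p2 q2 p3 q3 a b c M : R) :
  0 < M -> 0 <= a <= M -> 0 <= b <= M -> 0 <= c -> c <= a -> c <= b ->
  a ^+ 2 = p1 ^+ 2 + q1 ^+ 2 -> b ^+ 2 = p2 ^+ 2 + q2 ^+ 2 ->
  c ^+ 2 = p3 ^+ 2 + q3 ^+ 2 ->
  M ^+ 2 < (p1 - p2) ^+ 2 + (q1 - q2) ^+ 2 ->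
  M ^+ 2 < (p2 - p3) ^+ 2 + (q2 - q3) ^+ 2 ->
  M ^+ 2 < (p1 - p3) ^+ 2 + (q1 - q3) ^+ 2 ->
  `|p1 * q2 - p2 * q1| <= M ^+ 2 / 100 ->
  `|p2 * q3 - p3 * q2| <= M ^+ 2 / 100 ->
  [/\ 4 / 10 * (M * c) <= `|p2 * q3 - p3 * q2|,
      4 / 10 * (M * c) <= `|p1 * q3 - p3 * q1|,
      (p1 + p2 - p3) ^+ 2 + (q1 + q2 - q3) ^+ 2 < M ^+ 2,
      M ^+ 2 < (p3 - 2 * p1) ^+ 2 + (q3 - 2 * q1) ^+ 2 &
      (p1 - p3) ^+ 2 + (q1 - q3) ^+ 2 < (p1 - p2) ^+ 2 + (q1 - q2) ^+ 2].
Proof.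
move=> M0 haM hbM c0 ca cb ha hb hc h12 h23 h13 hg hal.
have [/andP[a0 aM] /andP[b0 bM]] := (haM, hbM).
have ac := long_if_far a0 c0 ha hc h13.
have bc := long_if_far b0 c0 hb hc h23.
have Ma : M / 2 <= a by lra.
have Mb : M / 2 <= b by lra.
have hx := dot_very_negative M0 haM hbM ha hb h12 Ma Mb hg.
have ab0 : 0 <= a * b by apply: mulr_ge0.
have x0 : p1 * p2 + q1 * q2 <= 0 by lra.
have al := area_with_short_vector M0 haM hbM c0 ca cb ha hb hc
  h23 h13 Ma Mb hg x0.
have be : 4 / 10 * (M * c) <= `|p1 * q3 - p3 * q1|.
  apply: (@area_with_short_vector _ p2 q2 _ _ _ _ b a c M) => //; last by lra.
  by rewrite distrC.
(* The area [|v x w|] is at least [4/10 M c] and, by flatness, at most [M^2 / 100]. Then [a] and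
   [b], which exceed [M - c], are almost [M]. *)
have cM : c <= M / 40.
  have : M * (4 / 10 * c) <= M * (M / 100) by rewrite expr2 in hal; lra.
  rewrite ler_pM2l //; lra.
have aM' : 39 / 40 * M <= a by lra.
have bM' : 39 / 40 * M <= b by lra.
have hab : (39 / 40 * M) * (39 / 40 * M) <= a * b by apply: ler_pM => //; lra.
have ha2 : (39 / 40 * M) * (39 / 40 * M) <= a * a by apply: ler_pM => //; lra.
have hb2 : (39 / 40 * M) * (39 / 40 * M) <= b * b by apply: ler_pM => //; lra.
have ha2M : a * a <= M * M by apply: ler_pM.
have hb2M : b * b <= M * M by apply: ler_pM.
have hc2 : c * c <= M / 40 * (M / 40) by apply: ler_pM.
have hacM : a * c <= M * (M / 40) by apply: ler_pM.
have hbcM : b * c <= M * (M / 40) by apply: ler_pM.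
have := dot_le_norms a0 c0 ha hc; rewrite ler_norml => /andP[t1 t2].
have := dot_le_norms b0 c0 hb hc; rewrite ler_norml => /andP[y1 y2].
have MM : 0 < M * M by apply: mulr_gt0.
have c2 : 0 <= c * c by apply: mulr_ge0.
rewrite !expr2 in ha hb hc *.
split => //; lra.
Qed.

(** * Limits along a set, finiteness and Dirichlet approximation *)

Lemma cvg_within_infty0 (R : realType) (f : nat -> R) (S : set nat) :
  (forall e, 0 < e -> exists s0, forall s, (s0 <= s)%N -> S s -> `|f s| < e) ->
  f s @[s --> within S \oo] --> (0 : R).
Proof.
move=> h; apply/cvgrPdist_lt => e /h[s0 hs0].
by exists s0 => // s /= s0s Ss; rewrite sub0r normrN; apply: hs0.
Qed.

(** The finitely many values before [s0] are dominated by the sum of their absolute values. *)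
Lemma ereal_sup_lt_pinfty (R : realType) (f : nat -> R) (S : set nat) (B : R) (s0 : nat) :
  (forall s, (s0 <= s)%N -> S s -> f s <= B) ->
  (ereal_sup [set (f s)%:E | s in S] < +oo)%E.
Proof.
move=> hB; pose C := Num.max B (\sum_(i < s0) `|f i|).
apply: (@le_lt_trans _ _ C%:E); last exact: ltry.
apply: ge_ereal_sup => _ [s Ss <-]; rewrite lee_fin le_max.
case: (leqP s0 s) => s0s; first by rewrite hB.
rewrite (bigD1 (Ordinal s0s)) //= orbC (le_trans (ler_norm _)) // lerDl.
exact: sumr_ge0.
Qed.

Lemma finite_nat_bounded (S : set nat) :
  finite_set S -> exists s0, forall s, (s0 <= s)%N -> ~ S s.
Proof.
move=> /finite_seqP[l ->]; exists (\sum_(x <- l) x).+1 => s ls /= sl.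
by move: ls; rewrite (big_rem s) //= ltnNge leq_addr.
Qed.

Lemma finite_bounded_mx (m n N : nat) :
  finite_set [set A : 'M[int]_(m, n) | forall i j, `|A i j| <= N%:Z].
Proof.
pose f (B : 'M['I_(2 * N).+1]_(m, n)) : 'M[int]_(m, n) :=
  \matrix_(i, j) ((B i j : nat)%:Z - N%:Z).
apply: (@sub_finite_set _ _ (f @` setT)); last by apply: finite_image; exact: finite_finset.
move=> A /= hA; exists (\matrix_(i, j) inord (absz (A i j + N%:Z))) => //.
apply/matrixP => i j; rewrite !mxE; have := hA i j; rewrite ler_norml => /andP[h1 h2].
have h0 : 0 <= A i j + N%:Z by rewrite -lerBlDr sub0r.
rewrite inordK; first by rewrite gez0_abs // addrK.
by rewrite -ltz_nat gez0_abs // intS [ltRHS]addrC ltzD1 mul2n -addnn PoszD lerD2r.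
Qed.

(** Pigeonhole: the fractional parts of [n t] for the [K + 2] integers [n] from 0 to [K + 1] lie in
    [K + 1] intervals of length [1 / (K + 1)]. *)
Lemma dirichlet_approx (R : realType) (t : R) (K : nat) :
  exists (b : nat) (a : int), (0 < b <= K.+1)%N /\ `|b%:R * t - a%:~R| <= K.+1%:R^-1.
Proof.
pose x (n : nat) : R := n%:R * t - (Num.floor (n%:R * t))%:~R.
have x01 n : 0 <= x n < 1.
  have /andP[h1 h2] := floor_itv (n%:R * t); rewrite intrD in h2.
  by rewrite /x; apply/andP; split; lra.
have K0 : 0 < K.+1%:R :> R by rewrite ltr0n.
pose fl n := Num.floor (K.+1%:R * x n).
have fl0 n : 0 <= fl n by rewrite floor_ge0; case/andP: (x01 n) => h _; exact: mulr_ge0.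
have flK n : (`|fl n| < K.+1)%N.
  rewrite -ltz_nat gez0_abs // floor_lt_int.
  by rewrite -[X in _ < X]mulr1 ltr_pM2l // (andP (x01 n)).2.
pose f (n : 'I_K.+2) : 'I_K.+1 := inord `|fl n|.
have /injectivePn[i [j nij fij]] : ~~ injectiveb f.
  by apply/injectiveP => /leq_card; rewrite !card_ord ltnn.
wlog lij : i j nij fij / (i < j)%N.
  move=> wl; case: (ltngtP i j) => h; [exact: wl h|apply: (wl j i) => //|].
    by rewrite eq_sym.
  by move: nij; rewrite -val_eqE /= h eqxx.
have eqfl : fl i = fl j.
  move/(congr1 val): fij; rewrite /= !inordK // => /(congr1 Posz).
  by rewrite !gez0_abs.
exists (j - i)%N, (Num.floor (j%:R * t) - Num.floor (i%:R * t)); split.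
  by rewrite subn_gt0 lij /= (leq_trans (leq_subr _ _)) // -ltnS ltn_ord.
have -> : (j - i)%:R * t - (Num.floor (j%:R * t) - Num.floor (i%:R * t))%:~R = x j - x i.
  by rewrite natrB ?intrB /x; [ring|exact: ltnW].
have /andP[hi1 hi2] := floor_itv (K.+1%:R * x i).
have /andP[hj1 hj2] := floor_itv (K.+1%:R * x j).
rewrite -/(fl i) in hi1 hi2; rewrite -/(fl j) in hj1 hj2.
rewrite intrD -eqfl in hj2; rewrite intrD in hi2; rewrite -eqfl in hj1.
rewrite -[leRHS]mul1r ler_pdivlMr // -[X in _ * X](ger0_norm (ltW K0)) -normrM.
rewrite ler_norml; apply/andP; split; lra.
Qed.

(** * Orthonormal coordinates adapted to [X] *)

Lemma sum_ord3 (V : nmodType) (F : 'I_3 -> V) : \sum_(i < 3) F i = F 0 + F 1 + F 2.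
Proof.
rewrite !big_ord_recl big_ord0 addr0 addrA; congr (_ + F _ + F _); exact: val_inj.
Qed.

Lemma forall_ord3 (P : 'I_3 -> Prop) : P 0 -> P 1 -> P 2 -> forall i, P i.
Proof.
move=> h0 h1 h2 [[|[|[|//]]] hi].
- by have -> : Ordinal hi = 0 by exact: val_inj.
- by have -> : Ordinal hi = 1 by exact: val_inj.
- by have -> : Ordinal hi = 2 by exact: val_inj.
Qed.

Lemma enum_ord3 : enum 'I_3 = [:: 0; 1; 2].
Proof. by apply: (inj_map val_inj); rewrite val_enum_ord. Qed.

Lemma perm_eq2P (T : eqType) (a b x y : T) :
  perm_eq [:: a; b] [:: x; y] -> (a = x /\ b = y) \/ (a = y /\ b = x).
Proof.
move=> h; have : a \in [:: x; y] by rewrite -(perm_mem h) mem_head.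
rewrite !inE => /orP[] /eqP e; subst a; [left|right]; split=> //; move: h.
  by rewrite perm_cons => /perm_small_eq-/(_ isT)[].
by rewrite (perm_sym _ [:: x; y]) (perm_catC [:: x] [:: y]) perm_cons => /perm_small_eq-/(_ isT)[].
Qed.

Lemma perm_eq3P (T : eqType) (a b c x y z : T) :
  perm_eq [:: a; b; c] [:: x; y; z] ->
  [\/ [/\ a = x, b = y & c = z], [/\ a = x, b = z & c = y]
   |  [\/ [/\ a = y, b = x & c = z], [/\ a = y, b = z & c = x],
          [/\ a = z, b = x & c = y] | [/\ a = z, b = y & c = x]]].
Proof.
move=> h; have : a \in [:: x; y; z] by rewrite -(perm_mem h) mem_head.
rewrite !inE => /or3P[] /eqP e; subst a; move: h.
- rewrite perm_cons => /perm_eq2P[][-> ->]; [by constructor 1|by constructor 2].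
- rewrite (perm_sym _ [:: x; y; z]) (perm_catCA [:: x] [:: y]) /= perm_cons perm_sym.
  move=> /perm_eq2P[][-> ->]; constructor 3; [by constructor 1|by constructor 2].
- rewrite (perm_sym _ [:: x; y; z]) (perm_catC [:: x; y] [:: z]) /= perm_cons perm_sym.
  move=> /perm_eq2P[][-> ->]; constructor 3; [by constructor 3|by constructor 4].
Qed.

Section Coordinates.
Variables (R : realType) (X : 'cV[R]_3).
Hypothesis X0_gt0 : 0 < X 0 0.

Let x0 := X 0 0.
Let x1 := X 1 0.
Let x2 := X 2 0.
Let r := Num.sqrt (x0 ^+ 2 + x1 ^+ 2).

(* Coordinates in the orthonormal basis
   [(- x1, x0, 0) / r], [(- x0 x2, - x1 x2, r^2) / (r |X|)], [X / |X|]. *)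
Definition pc (h : 'cV[R]_3) : R := (x0 * h 1 0 - x1 * h 0 0) / r.
Definition qc (h : 'cV[R]_3) : R :=
  (r ^+ 2 * h 2 0 - x2 * (x0 * h 0 0 + x1 * h 1 0)) / (r * enorm X).
Definition zc (h : 'cV[R]_3) : R := dot h X / enorm X.

Lemma dot3E (u v : 'cV[R]_3) : dot u v = u 0 0 * v 0 0 + u 1 0 * v 1 0 + u 2 0 * v 2 0.
Proof. exact: sum_ord3. Qed.

Lemma enorm_sqr (u : 'cV[R]_3) : enorm u ^+ 2 = dot u u.
Proof.
rewrite sqr_sqrtr // dot3E.
by have [[h1 h2] h3] := (sqr_ge0 (u 0 0), sqr_ge0 (u 1 0), sqr_ge0 (u 2 0)); lra.
Qed.

Lemma enorm_ge0 (u : 'cV[R]_3) : 0 <= enorm u.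
Proof. exact: sqrtr_ge0. Qed.

Lemma base_norm_sqr : r ^+ 2 = x0 ^+ 2 + x1 ^+ 2.
Proof. by rewrite sqr_sqrtr // addr_ge0 // sqr_ge0. Qed.

Lemma base_norm_gt0 : 0 < r.
Proof.
by rewrite sqrtr_gt0 ltr_pwDl ?sqr_ge0 // exprn_gt0.
Qed.

Lemma enormX_gt0 : 0 < enorm X.
Proof.
rewrite sqrtr_gt0 dot3E.
have h1 : 0 < X 0 0 * X 0 0 by exact: mulr_gt0.
by have [h2 h3] := (sqr_ge0 (X 1 0), sqr_ge0 (X 2 0)); lra.
Qed.

Lemma dotXX : dot X X = x0 ^+ 2 + x1 ^+ 2 + x2 ^+ 2.
Proof. by rewrite dot3E. Qed.

Lemma dot_coord (u v : 'cV[R]_3) : dot u v = pc u * pc v + qc u * qc v + zc u * zc v.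
Proof.
have [r0 N0] := (base_norm_gt0, enormX_gt0).
have E1 : pc u * pc v = (x0 * u 1 0 - x1 * u 0 0) * (x0 * v 1 0 - x1 * v 0 0) / r ^+ 2.
  by rewrite /pc; field; rewrite gt_eqF.
have E2 : qc u * qc v = (r ^+ 2 * u 2 0 - x2 * (x0 * u 0 0 + x1 * u 1 0)) *
   (r ^+ 2 * v 2 0 - x2 * (x0 * v 0 0 + x1 * v 1 0)) / (r ^+ 2 * enorm X ^+ 2).
  by rewrite /qc; field; rewrite !gt_eqF.
have E3 : zc u * zc v = dot u X * dot v X / enorm X ^+ 2.
  by rewrite /zc; field; rewrite gt_eqF.
have rn : x0 ^+ 2 + x1 ^+ 2 != 0 by rewrite -base_norm_sqr gt_eqF // exprn_gt0.
have Nn : x0 ^+ 2 + x1 ^+ 2 + x2 ^+ 2 != 0 by rewrite -dotXX -enorm_sqr gt_eqF // exprn_gt0.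
rewrite {}E1 {}E2 {}E3 enorm_sqr dotXX base_norm_sqr !dot3E -/x0 -/x1 -/x2.
by field; rewrite Nn rn.
Qed.

Lemma pcB (u v : 'cV[R]_3) : pc (u - v) = pc u - pc v.
Proof. by rewrite /pc !mxE; ring. Qed.
Lemma qcB (u v : 'cV[R]_3) : qc (u - v) = qc u - qc v.
Proof. by rewrite /qc !mxE; ring. Qed.
Lemma zcB (u v : 'cV[R]_3) : zc (u - v) = zc u - zc v.
Proof. by rewrite /zc dotBl mulrBl. Qed.
Lemma pcZ a (u : 'cV[R]_3) : pc (a *: u) = a * pc u.
Proof. by rewrite /pc !mxE; ring. Qed.
Lemma qcZ a (u : 'cV[R]_3) : qc (a *: u) = a * qc u.
Proof. by rewrite /qc !mxE; ring. Qed.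
Lemma zcZ a (u : 'cV[R]_3) : zc (a *: u) = a * zc u.
Proof. by rewrite /zc dotZl mulrA. Qed.

Lemma pcX : pc X = 0. Proof. by rewrite /pc -/x0 -/x1 (mulrC x0) subrr mul0r. Qed.
Lemma qcX : qc X = 0.
Proof. by rewrite /qc -/x0 -/x1 -/x2 base_norm_sqr (_ : _ - _ = 0) ?mul0r //; ring. Qed.
Lemma zcX : zc X = enorm X.
Proof. by rewrite /zc -enorm_sqr expr2 mulfK // gt_eqF // enormX_gt0. Qed.

(** Signed area spanned by the projections, that is, the component of the cross product along
    [X]. *)
Definition cr (u v : 'cV[R]_3) : R := pc u * qc v - pc v * qc u.

Lemma crE (u v : 'cV[R]_3) : cr u v =
  (x0 * (u 1 0 * v 2 0 - u 2 0 * v 1 0) + x1 * (u 2 0 * v 0 0 - u 0 0 * v 2 0)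
   + x2 * (u 0 0 * v 1 0 - u 1 0 * v 0 0)) / enorm X.
Proof.
have [r0 N0] := (base_norm_gt0, enormX_gt0).
have rn : x0 ^+ 2 + x1 ^+ 2 != 0 by rewrite -base_norm_sqr gt_eqF // exprn_gt0.
have -> : cr u v = ((x0 * u 1 0 - x1 * u 0 0) * (r ^+ 2 * v 2 0 - x2 * (x0 * v 0 0 + x1 * v 1 0))
  - (x0 * v 1 0 - x1 * v 0 0) * (r ^+ 2 * u 2 0 - x2 * (x0 * u 0 0 + x1 * u 1 0)))
   / r ^+ 2 / enorm X.
  by rewrite /cr /pc /qc; field; rewrite !gt_eqF.
rewrite base_norm_sqr; congr (_ / _); field => //.
Qed.

Lemma crBl u v w : cr (u - v) w = cr u w - cr v w.
Proof. by rewrite /cr pcB qcB; ring. Qed.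
Lemma crBr u v w : cr u (v - w) = cr u v - cr u w.
Proof. by rewrite /cr pcB qcB; ring. Qed.
Lemma crC u v : cr u v = - cr v u.
Proof. by rewrite /cr; ring. Qed.
Lemma cruu u : cr u u = 0.
Proof. by rewrite /cr; ring. Qed.

Definition nP (u : 'cV[R]_3) : R := enorm (projP X u).

Lemma nP_ge0 u : 0 <= nP u. Proof. exact: enorm_ge0. Qed.

Lemma dotXh_divr (h : 'cV[R]_3) : dot h X / dot X X = zc h / enorm X.
Proof. by rewrite -enorm_sqr expr2 invfM mulrA. Qed.

Lemma nP_sqr u : nP u ^+ 2 = pc u ^+ 2 + qc u ^+ 2.
Proof.
rewrite /nP enorm_sqr dot_coord /projP /projD pcB qcB zcB pcZ qcZ zcZ pcX qcX zcX.
rewrite dotXh_divr divfK ?gt_eqF ?enormX_gt0 //; ring.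
Qed.

Lemma nD_zc u : enorm (projD X u) = `|zc u|.
Proof.
rewrite /enorm dot_coord /projD pcZ qcZ zcZ pcX qcX zcX.
rewrite dotXh_divr divfK ?gt_eqF ?enormX_gt0 // !mulr0 !add0r -expr2.
exact: sqrtr_sqr.
Qed.

Lemma enorm_coord u : enorm u ^+ 2 = nP u ^+ 2 + zc u ^+ 2.
Proof. by rewrite enorm_sqr dot_coord nP_sqr. Qed.

Lemma projPB u v : projP X u - projP X v = projP X (u - v).
Proof. by rewrite /projP /projD dotBl; apply/colP => i; rewrite !mxE; ring. Qed.

Lemma nPB_sqr u v : nP (u - v) ^+ 2 = (pc u - pc v) ^+ 2 + (qc u - qc v) ^+ 2.
Proof. by rewrite nP_sqr pcB qcB. Qed.

Lemma nP_opp u v : nP (u - v) = nP (v - u).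
Proof.
apply/eqP; rewrite -(@eqrXn2 _ 2) ?nP_ge0 // !nPB_sqr; apply/eqP; ring.
Qed.

Lemma nPB_le u v : nP (u - v) <= nP u + nP v.
Proof.
have := @long_if_far _ (pc u) (qc u) (pc v) (qc v) (nP u) (nP v) (nP u + nP v)
  (nP_ge0 u) (nP_ge0 v) (nP_sqr u) (nP_sqr v).
rewrite ltxx => h; rewrite -(@ler_pXn2r _ 2) ?nnegrE ?addr_ge0 ?nP_ge0 //.
by rewrite nPB_sqr leNgt; apply/negP => /h.
Qed.

Lemma cr_le u v : `|cr u v| <= nP u * nP v.
Proof. apply: cross_le_norms; [exact: nP_ge0|exact: nP_ge0|exact: nP_sqr|exact: nP_sqr]. Qed.

(** The determinant in the adapted coordinates, expanded along the coordinate on [X]. *)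
Definition det3 (u v w : 'cV[R]_3) : R := zc w * cr u v + zc u * cr v w + zc v * cr w u.

(* [0] is interior to the triangle of projections, and the lattice basis has covolume 1. *)
Definition good (u v w : 'cV[R]_3) : Prop :=
  [/\ 0 < cr u v * cr v w, 0 < cr v w * cr w u, 0 < cr w u * cr u v,
      `|det3 u v w| = 1 & [/\ 0 <= zc u, 0 <= zc v & 0 <= zc w]].

(** A transposition changes the sign of all three areas and of the determinant at once; together
    with a 3-cycle it generates all orderings. *)
Lemma good_perm u v w u' v' w' :
  perm_eq [:: u; v; w] [:: u'; v'; w'] -> good u v w -> good u' v' w'.
Proof.
have swap a b c : good a b c -> good a c b.
  move=> [h1 h2 h3 h4 [h5 h6 h7]]; split => //.
  - by rewrite (crC a c) (crC c b) mulrNN mulrC.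
  - by rewrite (crC c b) (crC b a) mulrNN mulrC.
  - by rewrite (crC b a) (crC a c) mulrNN mulrC.
  - rewrite -h4 -normrN; congr `|_|; rewrite /det3 (crC a c) (crC c b) (crC b a); ring.
have rot a b c : good a b c -> good b c a.
  move=> [h1 h2 h3 h4 [h5 h6 h7]]; split => //.
  by rewrite -h4; congr `|_|; rewrite /det3; ring.
move=> /perm_eq3P[[-> -> ->]|[-> -> ->]|[[-> -> ->]|[-> -> ->]|[-> -> ->]|[-> -> ->]]] h;
  first [exact: h|exact: (swap _ _ _ h)|exact: (rot _ _ _ h)|exact: (rot _ _ _ (rot _ _ _ h))
        |exact: (swap _ _ _ (rot _ _ _ h))|exact: (rot _ _ _ (swap _ _ _ h))].
Qed.

(** The area [cr (v - u) w] is the sum of [cr v w] and [cr w u], which have the same sign, so the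
    origin stays inside the triangle. *)
Lemma good_step u v w : good u v w -> zc u <= zc v -> good u (v - u) w.
Proof.
move=> [h1 h2 h3 h4 [h5 h6 h7]] uv; have e1 : cr u (v - u) = cr u v by rewrite crBr cruu subr0.
have e2 : cr (v - u) w = cr v w + cr w u by rewrite crBl (crC u w) opprK.
split; rewrite ?e1 ?e2 //.
- by rewrite mulrDr addr_gt0 // mulrC.
- rewrite mulrDl addr_gt0 // -expr2 exprn_even_gt0 //=.
  by apply: contraTN h3 => /eqP->; rewrite mul0r ltxx.
- by rewrite -h4; congr `|_|; rewrite /det3 e1 e2 zcB; ring.
- by split => //; rewrite zcB subr_ge0.
Qed.

End Coordinates.

(** * The potential [M^2 - 10 A] *)

Lemma normrD_same_sign (R : realFieldType) (x y : R) : 0 < x * y -> `|x + y| = `|x| + `|y|.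
Proof.
case: (ltrgt0P x) => [x0|x0|->]; last by rewrite mul0r ltxx.
  by rewrite pmulr_rgt0 // => y0; rewrite !gtr0_norm ?addr_gt0.
by rewrite nmulr_rgt0 // => y0; rewrite (ltr0_norm y0) ltr0_norm ?opprD //; lra.
Qed.

Section Dynamics.
Variables (R : realType) (X : 'cV[R]_3).
Hypothesis X0_gt0 : 0 < X 0 0.

Definition area3 (u v w : 'cV[R]_3) : R := `|cr X u v| + `|cr X v w| + `|cr X w u|.
Definition mx3 (u v w : 'cV[R]_3) : R := Num.max (nP X u) (Num.max (nP X v) (nP X w)).
Definition potential (u v w : 'cV[R]_3) : R := mx3 u v w ^+ 2 - 10 * area3 u v w.

Lemma area3_perm u v w u' v' w' :
  perm_eq [:: u; v; w] [:: u'; v'; w'] -> area3 u v w = area3 u' v' w'.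
Proof.
have crN a b : `|cr X a b| = `|cr X b a| by rewrite crC normrN.
move=> /perm_eq3P[[-> -> ->]|[-> -> ->]|[[-> -> ->]|[-> -> ->]|[-> -> ->]|[-> -> ->]]];
  rewrite /area3 ?(crN w' v') ?(crN v' u') ?(crN u' w'); ring.
Qed.

Lemma mx3_perm u v w u' v' w' :
  perm_eq [:: u; v; w] [:: u'; v'; w'] -> mx3 u v w = mx3 u' v' w'.
Proof.
move=> /perm_eq3P[[-> -> ->]|[-> -> ->]|[[-> -> ->]|[-> -> ->]|[-> -> ->]|[-> -> ->]]];
  rewrite /mx3; move: (nP X u') (nP X v') (nP X w') => a b c;
  by rewrite ?(maxC c b) ?(maxC c a) ?(maxC b a) ?(maxCA b a) ?(maxCA c a) ?(maxC c b).
Qed.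

Lemma potential_perm u v w u' v' w' :
  perm_eq [:: u; v; w] [:: u'; v'; w'] -> potential u v w = potential u' v' w'.
Proof. by move=> h; rewrite /potential (mx3_perm h) (area3_perm h). Qed.

Lemma mx3P u v w B : (mx3 u v w <= B) = [&& nP X u <= B, nP X v <= B & nP X w <= B].
Proof. by rewrite /mx3 !ge_max. Qed.

Lemma le_mx3 u v w : [/\ nP X u <= mx3 u v w, nP X v <= mx3 u v w & nP X w <= mx3 u v w].
Proof. by apply/and3P; rewrite -mx3P. Qed.

Lemma mx3_ge0 u v w : 0 <= mx3 u v w.
Proof. by have [h _ _] := le_mx3 u v w; exact: le_trans (nP_ge0 X u) h. Qed.

Lemma area3_step u v w : good X u v w -> area3 u (v - u) w = area3 u v w + `|cr X w u|.
Proof.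
move=> [_ h _ _ _]; rewrite /area3 crBr cruu subr0 crBl (crC X u w) opprK.
by rewrite (normrD_same_sign h); ring.
Qed.

Lemma area3_ge0 u v w : 0 <= area3 u v w.
Proof. by rewrite !addr_ge0. Qed.

(** The square of the length grows by at most [2 M c + c^2 <= 3 M c], while ten times the area grows
    by at least [4 M c]. *)
Lemma potential_le u v w u' v' w' (c : R) :
  0 <= c -> c <= mx3 u v w ->
  mx3 u' v' w' <= mx3 u v w + c ->
  area3 u v w + 4 / 10 * (mx3 u v w * c) <= area3 u' v' w' ->
  potential u' v' w' <= potential u v w.
Proof.
move=> c0 cM MM AA; rewrite /potential.
move: (mx3_ge0 u v w) (mx3_ge0 u' v' w') cM MM AA.
move: (mx3 u v w) (mx3 u' v' w') (area3 u v w) (area3 u' v' w') => M M' A A' M0 M'0 cM MM AA.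
have : M' ^+ 2 <= (M + c) ^+ 2 by rewrite ler_pXn2r ?nnegrE // addr_ge0.
have : c * c <= M * c by rewrite ler_wpM2r.
have : 0 <= M * c by exact: mulr_ge0.
rewrite !expr2; lra.
Qed.

(* A flat step that lengthens the longest vector either enlarges the area enough, or is a
   step [v -> v - u] with [v] short; then the next step acts on [w] and [v - u], and it
   either undoes the lengthening or enlarges the area. *)
Lemma potential_decreases u v w : good X u v w ->
  100 * area3 u v w < mx3 u v w ^+ 2 ->
  nP X (v - u) <= nP X (w - v) -> nP X (v - u) <= nP X (w - u) ->
  potential u (v - u) w <= potential u v w \/
  forall u' v' w', perm_eq [:: u; v - u; w] [:: u'; v'; w'] -> good X u' v' w' ->
    nP X (v' - u') <= nP X (w' - v') -> nP X (v' - u') <= nP X (w' - u') ->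
    potential u' (v' - u') w' <= potential u v w.
Proof.
move=> gd flat s1 s2.
have [lu lv lw] := le_mx3 u v w.
have [[nu nv] nw] := (nP_ge0 X u, nP_ge0 X v, nP_ge0 X w).
have M0 := mx3_ge0 u v w.
case: (lerP (nP X (v - u)) (mx3 u v w)) => [short|far].
  left; apply: (@potential_le _ _ _ _ _ _ 0) => //.
    by rewrite addr0 mx3P lu lw short.
  by rewrite !mulr0 addr0 area3_step // lerDl.
set M := mx3 u v w in flat lu lv lw M0 far.
have Mgt0 : 0 < M.
  rewrite lt_neqAle M0 andbT; apply: contraTneq flat => <-.
  by rewrite -leNgt expr0n /= mulr_ge0 // area3_ge0.
have sq a : M < nP X a -> M ^+ 2 < nP X a ^+ 2.
  by move=> h; rewrite ltr_pXn2r // ?nnegrE // ltW // (lt_trans Mgt0).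
have far2 := sq _ far; have far3 := sq _ (lt_le_trans far s1).
have far4 := sq _ (lt_le_trans far s2).
have [A1 A2 A3] : [/\ `|cr X u v| <= M ^+ 2 / 100, `|cr X v w| <= M ^+ 2 / 100
    & `|cr X w u| <= M ^+ 2 / 100].
  move: flat (normr_ge0 (cr X u v)) (normr_ge0 (cr X v w)) (normr_ge0 (cr X w u)).
  rewrite /area3; move: (M) `|_| `|_| `|_| => m a b c; clear; move=> *; split; lra.
have crN a b : `|cr X a b| = `|cr X b a| by rewrite crC normrN.
have shape a b c : nP X a <= M -> nP X b <= M -> nP X c <= nP X a -> nP X c <= nP X b ->
    M ^+ 2 < nP X (a - b) ^+ 2 -> M ^+ 2 < nP X (b - c) ^+ 2 -> M ^+ 2 < nP X (a - c) ^+ 2 ->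
    `|cr X a b| <= M ^+ 2 / 100 -> `|cr X b c| <= M ^+ 2 / 100 ->
    [/\ 4 / 10 * (M * nP X c) <= `|cr X b c|, 4 / 10 * (M * nP X c) <= `|cr X a c|,
     nP X (b - (c - a)) < M, M < nP X (c - a - a) & nP X (a - c) < nP X (a - b)].
  move=> h1 h2 h3 h4 h5 h6 h7 h8 h9.
  rewrite !(nPB_sqr X0_gt0) in h5 h6 h7.
  have := flat_triangle_shape Mgt0 _ _ (nP_ge0 X c) h3 h4 (nP_sqr X0_gt0 a) (nP_sqr X0_gt0 b)
    (nP_sqr X0_gt0 c) h5 h6 h7 h8 h9; rewrite !nP_ge0 => /(_ h1 h2)[k1 k2 k3 k4 k5].
  have lt_sq (x y : R) : 0 <= x -> 0 <= y -> x ^+ 2 < y ^+ 2 -> x < y.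
    by move=> x0 y0; rewrite ltr_pXn2r.
  split; [exact: k1|exact: k2| | |].
  - apply: lt_sq; [exact: nP_ge0|exact: M0|rewrite (nPB_sqr X0_gt0) pcB qcB].
    rewrite (_ : _ + _ = (pc X a + pc X b - pc X c) ^+ 2 + (qc X a + qc X b - qc X c) ^+ 2) //.
    by ring.
  - apply: lt_sq; [exact: M0|exact: nP_ge0|rewrite (nPB_sqr X0_gt0) pcB qcB].
    rewrite (_ : _ + _ = (pc X c - 2 * pc X a) ^+ 2 + (qc X c - 2 * qc X a) ^+ 2) //.
    by ring.
  - by apply: lt_sq; [exact: nP_ge0|exact: nP_ge0|rewrite !(nPB_sqr X0_gt0)].
have nPC := nP_opp X0_gt0.
have subl a b : nP X (a - b) <= nP X a + nP X b by exact: nPB_le.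
(* With [u] shortest, the new length is at most [M + |u|], and the area gains
   [|w x u| >= 4/10 M |u|]. *)
have small_u : nP X u <= nP X v -> nP X u <= nP X w -> potential u (v - u) w <= potential u v w.
  move=> uv uw; rewrite (nPC w v) in far3.
  have [k _ _ _ _] := shape v w u lv lw uv uw far3 far4 far2 A2 A3.
  apply: (@potential_le _ _ _ _ _ _ (nP X u)) => //; rewrite -/M.
    rewrite mx3P; apply/and3P; split; [by rewrite lerDr| |by apply: (le_trans lw); rewrite lerDl].
    by apply: (le_trans (subl _ _)); rewrite lerD2r.
  by rewrite area3_step // lerD2l.
(* With [w] shortest, the side [u - w] would be shorter than [u - v], against the choice of the
   side. *)
have small_w : nP X w <= nP X u -> nP X w <= nP X v -> False.
  move=> wu wv; rewrite (nPC w v) in far3; rewrite (nPC w u) in far4 s2.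
  rewrite (nPC v u) in far2 s2.
  have [_ _ _ _ k] := shape u v w lu lv wu wv far2 far3 far4 A1 A2.
  by move: (lt_le_trans k s2); rewrite ltxx.
case: (lerP (nP X v) (nP X u)) => [vu|/ltW uv]; last first.
  case: (lerP (nP X u) (nP X w)) => [uw|/ltW wu]; first by left; apply: small_u.
  by case: small_w => //; exact: le_trans uv.
case: (lerP (nP X v) (nP X w)) => [vw|/ltW wv]; last first.
  by case: small_w => //; exact: le_trans vu.
have farwu := lt_le_trans far s2.
(* Now [v] is shortest. In the next triangle both sides at [u] exceed [M] and the third does not, so
   only the two orderings acting on [w] and [v - u] survive. *)
right; rewrite (nPC w u) in far4; rewrite (nPC v u) in far2; rewrite crN in A3; rewrite crN in A2.
have [_ k2 k3 k4 _] := shape u w v lu lw vu vw far4 far3 far2 A3 A2.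
have k3' : nP X (v - u - w) < M by rewrite nPC.
have k4' : M < nP X (u - (v - u)) by rewrite nPC.
have farwu' : M < nP X (u - w) by rewrite nPC.
move=> u' v' w'; rewrite perm_sym => pe gd' s1' s2'.
have areaE : area3 u' v' w' = area3 u v w + `|cr X w u| by rewrite (area3_perm pe) area3_step.
have areaS := area3_step gd'.
move: pe areaE areaS s1' s2'.
move=> /perm_eq3P[[-> -> ->]|[-> -> ->]|[[-> -> ->]|[-> -> ->]|[-> -> ->]|[-> -> ->]]]
  areaE areaS s1' s2'.
- by move: (lt_trans k4 (le_lt_trans s1' k3)); rewrite ltxx.
- by move: (lt_trans farwu (le_lt_trans s1' k3')); rewrite ltxx.
- by move: (lt_trans k4' (le_lt_trans s2' k3)); rewrite ltxx.
(* Here [w] becomes [w - (v - u)]: lengths are at most [M + |v|], and this second step adds the area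
   [|u x v| >= 4/10 M |v|]. *)
- apply: (@potential_le _ _ _ _ _ _ (nP X v)) => //; rewrite -/M.
    rewrite mx3P; apply/and3P; split.
    + by apply: (le_trans (subl _ _)); rewrite addrC lerD2r.
    + by apply: (le_trans (ltW k3)); rewrite lerDl.
    + by apply: (le_trans lu); rewrite lerDl.
  rewrite areaS areaE crBr cruu subr0 -[leRHS]addrA lerD2l; by apply: (le_trans k2); rewrite lerDr.
- by move: (lt_trans farwu' (le_lt_trans s2' k3')); rewrite ltxx.
(* Here [v - u] becomes [v - u - w]: all lengths are again at most [M]. *)
- apply: (@potential_le _ _ _ _ _ _ 0) => //; rewrite -/M.
    by rewrite addr0 mx3P lu lw (ltW k3').
  by rewrite !mulr0 addr0 areaS areaE -[leRHS]addrA lerDl addr_ge0.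
Qed.

End Dynamics.

(** * Thick triangles and badly approximable vectors *)

(** Here [n] is the squared length of a projection and [z] a coordinate along [X]. For large [M] the
    term [z^3] is at most [c / 2], so the other half of [c] comes from [n z], and [z M^2 <= E]. *)
Lemma bad_lower_bound (R : realFieldType) (c z n M E : R) :
  0 < c -> 0 <= z -> 0 <= n -> z * M ^+ 2 <= E -> 1 <= M -> E <= M -> 2 / c * E <= M ->
  c < (n + z ^+ 2) * z -> c / 2 * M ^+ 2 <= n * E.
Proof.
move=> c0 z0 n0 zE M1 EM cM hc.
have M0 : 0 < M by lra.
have zM : z * M <= E.
  by apply: le_trans zE; rewrite ler_wpM2l // expr2 ler_peMl // ltW.
have z1 : z <= 1 by rewrite -(ler_pM2r M0) mul1r (le_trans zM).
have zc : z <= c / 2.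
  rewrite -(ler_pM2r M0) (le_trans zM) //.
  have : c / 2 * (2 / c * E) <= c / 2 * M by rewrite ler_wpM2l // ltW // divr_gt0.
  by rewrite mulrA mulf_div [c * 2]mulrC divff ?mul1r // mulf_neq0 // gt_eqF.
have z3 : z ^+ 2 * z <= c / 2.
  apply: le_trans zc; rewrite -[leRHS]mul1r ler_wpM2r //.
  by rewrite expr2 -[leRHS]mul1r ler_pM.
have nz : c / 2 <= n * z by rewrite mulrDl in hc; lra.
apply: (@le_trans _ _ (n * z * M ^+ 2)); first by rewrite ler_wpM2r // sqr_ge0.
by rewrite -mulrA ler_wpM2l.
Qed.

Section BadlyApproximable.
Variables (R : realType) (X : 'cV[R]_3).
Hypothesis X0_gt0 : 0 < X 0 0.

(** The areas share one sign and the coordinates are nonnegative, so nothing cancels in the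
    determinant. *)
Lemma good_det u v w : good X u v w ->
  zc X w * `|cr X u v| + zc X u * `|cr X v w| + zc X v * `|cr X w u| = 1.
Proof.
move=> [h1 h2 h3 <- [z1 z2 z3]]; rewrite /det3.
case: (ltrgt0P (cr X u v)) h1 h3 => [x0|x0|->]; last by rewrite mul0r ltxx.
  rewrite pmulr_rgt0 // mulrC pmulr_rgt0 // => y0 w0; rewrite (gtr0_norm y0) (gtr0_norm w0).
  by rewrite ger0_norm // !addr_ge0 // mulr_ge0 // ltW.
rewrite nmulr_rgt0 // mulrC nmulr_rgt0 // => y0 w0; rewrite (ltr0_norm y0) (ltr0_norm w0).
rewrite !mulrN -!opprD ler0_norm // -oppr_ge0 !opprD -!mulrN.
by rewrite !addr_ge0 // mulr_ge0 // oppr_ge0 ltW.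
Qed.

(** Multiplied by [|u|^2], [v x w] is a combination of [w x u] and [u x v] with coefficients [u.v]
    and [u.w], of size at most [|u| M <= k |u|^2]. *)
Lemma area_first_le u v w (k : R) : 0 <= k -> mx3 X u v w <= k * nP X u -> 0 < nP X u ->
  `|cr X v w| <= k * (`|cr X w u| + `|cr X u v|).
Proof.
move=> k0 Mk n0; have [lu lv lw] := le_mx3 X u v w.
have E : cr X v w * nP X u ^+ 2 =
  - (cr X w u * (pc X u * pc X v + qc X u * qc X v)
     + cr X u v * (pc X u * pc X w + qc X u * qc X w)).
  by rewrite (nP_sqr X0_gt0) /cr; ring.
have D1 := dot_le_norms (nP_ge0 X u) (nP_ge0 X v) (nP_sqr X0_gt0 u) (nP_sqr X0_gt0 v).
have D2 := dot_le_norms (nP_ge0 X u) (nP_ge0 X w) (nP_sqr X0_gt0 u) (nP_sqr X0_gt0 w).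
have n2 : 0 < nP X u ^+ 2 by rewrite exprn_gt0.
rewrite -(ler_pM2r n2) -[X in _ * X <= _](ger0_norm (ltW n2)) -normrM E normrN.
apply: (le_trans (ler_normD _ _)); rewrite !normrM.
have -> : k * (`|cr X w u| + `|cr X u v|) * nP X u ^+ 2 =
   `|cr X w u| * (nP X u * (k * nP X u)) + `|cr X u v| * (nP X u * (k * nP X u)) by ring.
apply: lerD; apply: ler_wpM2l => //.
  by apply: (le_trans D1); apply: ler_wpM2l; [exact: nP_ge0|exact: le_trans Mk].
by apply: (le_trans D2); apply: ler_wpM2l; [exact: nP_ge0|exact: le_trans Mk].
Qed.

(** Pythagoras for the components of the projection along [u] and across [u]. *)
Lemma nP_comb_sqr u v (a b : R) : 0 < nP X u ->
  nP X (a *: u - b *: v) ^+ 2 =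
  nP X u ^+ 2 * (a - b * ((pc X u * pc X v + qc X u * qc X v) / nP X u ^+ 2)) ^+ 2
  + b ^+ 2 * cr X u v ^+ 2 / nP X u ^+ 2.
Proof.
move=> n0; have n1 : nP X u ^+ 2 != 0 by rewrite gt_eqF // exprn_gt0.
rewrite (nPB_sqr X0_gt0) !pcZ !qcZ /cr.
rewrite (nP_sqr X0_gt0) in n1 *; by field.
Qed.

(** Let [T = |w x u| + |u x v|]. The determinant gives [zc v T <= 1], and thickness with
    [area_first_le] gives [M^2 <= 100 (1 + k) T]. *)
Lemma zc_second_bound u v w k : good X u v w -> zc X u <= zc X v <= zc X w ->
  0 <= k -> mx3 X u v w <= k * nP X u -> 0 < nP X u ->
  mx3 X u v w ^+ 2 <= 100 * area3 X u v w ->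
  zc X v * mx3 X u v w ^+ 2 <= 100 * (1 + k).
Proof.
move=> gd /andP[z01 z12] k0 Mk n0 thick.
have := good_det gd; have a0 := area_first_le k0 Mk n0.
case: gd => _ _ _ _ [z0 z1 z2].
have [[h1 h2] h3] := (normr_ge0 (cr X u v), normr_ge0 (cr X v w), normr_ge0 (cr X w u)).
move: thick; rewrite /area3.
move: `|cr X u v| `|cr X v w| `|cr X w u| (mx3 X u v w ^+ 2) h1 h2 h3 a0 => a2 a0 a1 M2 h1 h2 h3 H.
move: (zc X u) (zc X v) (zc X w) z0 z1 z2 z01 z12 => x y z; clear -k0 H h1 h2 h3.
move=> x0 y0 z0 xy yz thick det.
have e1 : y * (a1 + a2) <= 1.
  have : y * a2 <= z * a2 by rewrite ler_wpM2r.
  have : 0 <= x * a0 by rewrite mulr_ge0.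
  lra.
have e2 : y * M2 <= y * (100 * ((1 + k) * (a1 + a2))).
  by rewrite ler_wpM2l // (le_trans thick) // ler_wpM2l //; lra.
have e3 : (1 + k) * (y * (a1 + a2)) <= (1 + k) * 1 by rewrite ler_wpM2l //; lra.
lra.
Qed.


(* If [u] and [v] were nearly dependent in the plane, an integer combination supplied by
   Dirichlet's theorem would violate bad approximability. *)
Lemma area_last_lower_bound (c k : R) : 0 < c -> 1 <= k ->
  (forall h : 'cV[int]_3, h != 0 ->
     c < enorm (toR R h) ^+ 2 * enorm (projD X (toR R h))) ->
  exists D B : R, 0 <= D /\ forall (hu hv : 'cV[int]_3) w,
    let u := toR R hu in let v := toR R hv in
    good X u v w -> zc X u <= zc X v -> mx3 X u v w <= k * nP X u -> 0 < nP X u ->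
    zc X v * mx3 X u v w ^+ 2 <= 100 * (1 + k) ->
    B <= mx3 X u v w -> mx3 X u v w ^+ 2 <= D * `|cr X u v|.
Proof.
move=> c0 k1 bad.
pose C2 := (k + 2) * (100 * (1 + k)).
have C20 : 0 < C2 by rewrite /C2 !mulr_gt0 //; lra.
(* [K >= 4 C2 / c] is what later absorbs the Dirichlet error term [C2 M^4 / K]. *)
pose K' := `|Num.ceil (4 * C2 / c)|%N; pose K : R := K'.+1%:R.
have K1 : 1 <= K by rewrite ler1n.
have K0 : 0 < K by lra.
have KC : 4 * C2 / c <= K.
  apply: (le_trans (ceil_ge _)); rewrite /K -[K'.+1%:R]natr1.
  have h : 0 <= 4 * C2 / c by apply/ltW; rewrite divr_gt0 // mulr_gt0.
  have cC : 0 <= Num.ceil (4 * C2 / c) by rewrite -(ler_int R); apply: le_trans (ceil_ge _).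
  have -> : K'%:R = (Num.ceil (4 * C2 / c))%:~R :> R by rewrite pmulrn /K' gez0_abs.
  by rewrite lerDl.
pose E := K * C2; pose D := 1 + 4 * (K ^+ 3 * k ^+ 2 * C2) / c.
have D1 : 1 <= D.
  by rewrite lerDl; apply/ltW; rewrite divr_gt0 // !mulr_gt0 // ?exprn_gt0 //; lra.
(* The threshold yields the three size conditions of [bad_lower_bound]. *)
exists D, (1 + E + 2 / c * E); split; first by lra.
move=> hu hv w u v gd zuv Mk n0 zM MB.
set M := mx3 X u v w in Mk zM MB *.
have E0 : 0 < E by rewrite mulr_gt0.
have cE : 0 < 2 / c * E by rewrite mulr_gt0 ?divr_gt0.
have M1 : 1 <= M by lra.
have M0 : 0 < M by lra.
have [lu lv _] := le_mx3 X u v w; rewrite -/M in lu lv.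
have [zu zv cuv] : [/\ 0 <= zc X u, 0 <= zc X v & cr X u v != 0].
  by case: gd => [h _ _ _ [? ? _]]; split=> //; apply: contraTneq h => ->; rewrite mul0r ltxx.
have n2 : 0 < nP X u ^+ 2 by rewrite exprn_gt0.
pose t := (pc X u * pc X v + qc X u * qc X v) / nP X u ^+ 2.
have tk : `|t| <= k.
  rewrite /t normrM normfV (ger0_norm (ltW n2)) ler_pdivrMr //.
  apply: (le_trans (dot_le_norms (nP_ge0 X u) (nP_ge0 X v) (nP_sqr X0_gt0 u) (nP_sqr X0_gt0 v))).
  rewrite expr2 mulrA [leRHS]mulrC; apply: ler_wpM2l; first exact: nP_ge0.
  exact: le_trans lv Mk.
(* [t u] is the projection of [v] on the direction of [u] in the plane; approximating [t] by [a / b]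
   makes the component of [a u - b v] along [u] small. *)
have [b [a [/andP[b0 bK] tab]]] := dirichlet_approx t K'; rewrite -/K in tab.
have bR0 : 0 < b%:R :> R by rewrite ltr0n.
have bRK : b%:R <= K by rewrite /K ler_nat.
pose h : 'cV[int]_3 := a *: hu - b%:Z *: hv.
have hE : toR R h = a%:~R *: u - b%:R *: v.
  by apply/colP => i; rewrite !mxE intrB !intrM.
have h0 : h != 0.
  apply/eqP => h0; have : cr X u (toR R h) = 0.
    by rewrite h0 /cr /pc /qc !mxE; ring.
  rewrite hE crBr /cr !pcZ !qcZ => /eqP; rewrite (_ : _ - _ = - (b%:R * cr X u v)); last first.
    by rewrite /cr; ring.
  by rewrite oppr_eq0 mulf_eq0 (gt_eqF bR0) (negPf cuv).
have := bad h h0; rewrite (enorm_coord X0_gt0) (nD_zc X0_gt0) hE.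
rewrite -(real_normK (num_real (zc X _))) => hbad.
(* The coefficients satisfy [|a| <= K k + 1] and [b <= K], and [zc u <= zc v], so the coordinate is
   at most [K (k + 2) zc v]. *)
have zE : `|zc X (a%:~R *: u - b%:R *: v)| * M ^+ 2 <= E.
  have aK : `|a%:~R : R| <= K * k + 1.
    have -> : a%:~R = b%:R * t - (b%:R * t - a%:~R) by ring.
    apply: (le_trans (ler_normB _ _)); apply: lerD; last first.
      by apply: (le_trans tab); rewrite invf_le1.
    by rewrite normrM (ger0_norm (ltW bR0)); apply: ler_pM => //; exact: ltW.
  have : `|zc X (a%:~R *: u - b%:R *: v)| <= K * (k + 2) * zc X v.
    rewrite zcB !zcZ; apply: (le_trans (ler_normB _ _)).
    rewrite (normrM _ (zc X u)) (normrM _ (zc X v)) (ger0_norm zu) (ger0_norm zv).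
    rewrite (ger0_norm (ltW bR0)).
    have e1 : `|a%:~R : R| * zc X u <= (K * k + 1) * zc X v by apply: ler_pM.
    have e2 : b%:R * zc X v <= K * zc X v by rewrite ler_wpM2r.
    have e3 : 1 * zc X v <= K * zc X v by rewrite ler_wpM2r.
    lra.
  move=> e; apply: (@le_trans _ _ (K * (k + 2) * zc X v * M ^+ 2)).
    by rewrite ler_wpM2r // sqr_ge0.
  rewrite -mulrA /E /C2 -mulrA; apply: ler_wpM2l; first exact: ltW.
  by apply: ler_wpM2l => //; lra.
have EM : E <= M by lra.
have cEM : 2 / c * E <= M by lra.
have lower := bad_lower_bound c0 (normr_ge0 _) (sqr_ge0 _) zE M1 EM cEM hbad.
(* The part along [u] is at most [M / K], the part across at most [K |u x v| / |u|], and
   [M / |u| <= k]. *)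
have upper : nP X (a%:~R *: u - b%:R *: v) ^+ 2 * M ^+ 2 <=
   M ^+ 2 * M ^+ 2 / K ^+ 2 + K ^+ 2 * k ^+ 2 * cr X u v ^+ 2.
  rewrite nP_comb_sqr // -/t mulrDl; apply: lerD.
    rewrite [leRHS]mulrAC; apply: ler_wpM2r; first exact: sqr_ge0.
    apply: ler_pM; rewrite ?sqr_ge0 //.
      by rewrite ler_pXn2r ?nnegrE // ltW.
    rewrite -exprVn -(real_normK (num_real (_ - _))) ler_pXn2r ?nnegrE ?invr_ge0 ?(ltW K0) //.
    by rewrite distrC.
  have Mk2 : M ^+ 2 / nP X u ^+ 2 <= k ^+ 2.
    by rewrite ler_pdivrMr // -exprMn ler_pXn2r ?nnegrE ?mulr_ge0 ?nP_ge0 ?(ltW M0) //; lra.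
  have -> : b%:R ^+ 2 * cr X u v ^+ 2 / nP X u ^+ 2 * M ^+ 2 =
     b%:R ^+ 2 * (M ^+ 2 / nP X u ^+ 2) * cr X u v ^+ 2 by ring.
  apply: ler_wpM2r; first exact: sqr_ge0.
  apply: ler_pM => //; rewrite ?sqr_ge0 ?divr_ge0 ?sqr_ge0 //.
  by rewrite ler_pXn2r ?nnegrE // ltW.
(* Comparing the two bounds, the error [C2 / K <= c / 4] uses up only half of [c / 2]. *)
have main : c / 4 * (M ^+ 2 * M ^+ 2) <= K ^+ 3 * k ^+ 2 * C2 * cr X u v ^+ 2.
  have l2 : c / 2 * (M ^+ 2 * M ^+ 2) <=
      (M ^+ 2 * M ^+ 2 / K ^+ 2 + K ^+ 2 * k ^+ 2 * cr X u v ^+ 2) * E.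
    rewrite mulrA; apply: (@le_trans _ _ (nP X (a%:~R *: u - b%:R *: v) ^+ 2 * E * M ^+ 2)).
      by rewrite ler_wpM2r // sqr_ge0.
    by rewrite mulrAC; apply: ler_wpM2r => //; exact: ltW.
  have CK : C2 / K <= c / 4.
    by rewrite ler_pdivrMr //; move: KC; rewrite ler_pdivrMr //; lra.
  have e1 : (M ^+ 2 * M ^+ 2 / K ^+ 2 + K ^+ 2 * k ^+ 2 * cr X u v ^+ 2) * E =
     M ^+ 2 * M ^+ 2 * (C2 / K) + K ^+ 3 * k ^+ 2 * C2 * cr X u v ^+ 2.
    by rewrite /E; field; rewrite gt_eqF.
  have e2 : M ^+ 2 * M ^+ 2 * (C2 / K) <= M ^+ 2 * M ^+ 2 * (c / 4).
    by apply: ler_wpM2l => //; rewrite mulr_ge0 // sqr_ge0.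
  rewrite e1 in l2; move: l2 e2.
  move: (M ^+ 2 * M ^+ 2 * (C2 / K)) (K ^+ 3 * k ^+ 2 * C2 * cr X u v ^+ 2).
  by move: (M ^+ 2 * M ^+ 2) => x y z; clear; lra.
apply: le_of_sqr; first by rewrite mulr_ge0 //; lra.
rewrite [leRHS]exprMn real_normK ?num_real //.
apply: (@le_trans _ _ ((D - 1) * cr X u v ^+ 2)).
  have -> : (D - 1) * cr X u v ^+ 2 = 4 / c * (K ^+ 3 * k ^+ 2 * C2 * cr X u v ^+ 2).
    by rewrite /D; ring.
  have -> : (M ^+ 2) ^+ 2 = 4 / c * (c / 4 * (M ^+ 2 * M ^+ 2)) by field; rewrite gt_eqF.
  by apply: ler_wpM2l => //; rewrite divr_ge0 // ltW.
apply: ler_wpM2r; first exact: sqr_ge0.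
apply: (@le_trans _ _ D); first by lra.
by rewrite expr2 ler_peMl //; lra.
Qed.

(** Bad approximability at [u] makes [M] comparable to [|u|]; this bounds [zc v], hence
    [M^2 <= D |u x v|]. The determinant gives [zc w |u x v| <= 1], so [D] itself is the bound. *)
Lemma bad_thick_bound : badly_approximable X ->
  exists C B : R, forall (hu hv : 'cV[int]_3) w,
    let u := toR R hu in let v := toR R hv in
    good X u v w -> zc X u <= zc X v <= zc X w -> hu != 0 ->
    mx3 X u v w ^+ 2 <= 100 * area3 X u v w -> B <= mx3 X u v w ->
    mx3 X u v w ^+ 2 * zc X w <= C.
Proof.
move=> [c c0 bad]; pose k := 1 + 200 / c.
have k1 : 1 <= k by rewrite lerDl divr_ge0 // ltW.
have [D [B [D0 HD]]] := area_last_lower_bound c0 k1 bad.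
exists D, (Num.max B (100 + 2 / c * 100)) => hu hv w u v gd zs hu0 thick.
rewrite ge_max => /andP[BM M100].
have [z01 z12] := andP zs.
have [z0 z1 z2] : [/\ 0 <= zc X u, 0 <= zc X v & 0 <= zc X w] by case: gd.
have cc : 0 < 2 / c * 100 by rewrite mulr_gt0 ?divr_gt0.
have det := good_det gd.
have zM : zc X u * mx3 X u v w ^+ 2 <= 100.
  have e : zc X u * area3 X u v w <= 1.
    rewrite -det /area3 !mulrDr.
    have e1 : zc X u * `|cr X u v| <= zc X w * `|cr X u v|.
      by rewrite ler_wpM2r // (le_trans z01).
    have e2 : zc X u * `|cr X w u| <= zc X v * `|cr X w u| by rewrite ler_wpM2r.
    lra.
  have := ler_wpM2l z0 thick; lra.
have M1 : 1 <= mx3 X u v w by lra.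
have M0 : 0 < mx3 X u v w by lra.
have hb : c < (nP X u ^+ 2 + zc X u ^+ 2) * zc X u.
  by have := bad hu hu0; rewrite (enorm_coord X0_gt0) (nD_zc X0_gt0) (ger0_norm z0).
have E1 : 100 <= mx3 X u v w by lra.
have E2 : 2 / c * 100 <= mx3 X u v w by lra.
have low := bad_lower_bound c0 z0 (sqr_ge0 _) zM M1 E1 E2 hb.
(* [low] says [M^2 <= 200 / c |u|^2 = (k - 1) |u|^2], and [k - 1 <= k^2]. *)
have Mk : mx3 X u v w <= k * nP X u.
  apply: le_of_sqr; first by rewrite mulr_ge0 ?nP_ge0 //; lra.
  have -> : mx3 X u v w ^+ 2 = 2 / c * (c / 2 * mx3 X u v w ^+ 2) by field; rewrite gt_eqF.
  apply: (@le_trans _ _ (2 / c * (nP X u ^+ 2 * 100))).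
    by rewrite ler_wpM2l // divr_ge0 // ltW.
  rewrite exprMn (_ : 2 / c * _ = (k - 1) * nP X u ^+ 2); last by rewrite /k; ring.
  apply: ler_wpM2r; first exact: sqr_ge0.
  by apply: (@le_trans _ _ k); [lra|rewrite expr2 ler_peMl //; lra].
have n0 : 0 < nP X u.
  rewrite lt_neqAle nP_ge0 andbT eq_sym; apply/eqP => n0; move: Mk; rewrite n0 mulr0; lra.
have k0 : 0 <= k by lra.
have zv := zc_second_bound gd zs k0 Mk n0 thick.
have MD := HD hu hv w gd z01 Mk n0 zv BM.
apply: (@le_trans _ _ (D * `|cr X u v| * zc X w)); first by rewrite ler_wpM2r.
rewrite -mulrA -[leRHS]mulr1; apply: ler_wpM2l => //.
have : 0 <= zc X u * `|cr X v w| by rewrite mulr_ge0.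
have : 0 <= zc X v * `|cr X w u| by rewrite mulr_ge0.
rewrite mulrC; lra.
Qed.

End BadlyApproximable.

(** * Runs of the algorithm *)

Lemma max3P (R : realType) (f : 'I_3 -> R) (B : R) :
  (max3 f <= B) = [&& f 0 <= B, f 1 <= B & f 2 <= B].
Proof. by rewrite /max3 !ge_max. Qed.

Lemma le_max3 (R : realType) (f : 'I_3 -> R) i : f i <= max3 f.
Proof. by move: i; apply: forall_ord3; have := lexx (max3 f); rewrite max3P => /and3P[]. Qed.

Lemma gcol_subcol (R : realType) (G : 'M[int]_3) (i j l : 'I_3) :
  gcol R (subcol G i j) l = if l == j then gcol R G j - gcol R G i else gcol R G l.
Proof. by apply/colP => k; rewrite !mxE; case: eqP => _; rewrite !mxE ?intrB. Qed.

(** Steps reorder the columns arbitrarily, so columns are compared as lists up to [perm_eq]. *)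
Definition colseq (R : realType) (G : 'M[int]_3) : seq 'cV[R]_3 :=
  [:: gcol R G 0; gcol R G 1; gcol R G 2].

Lemma colseq_perm (R : realType) (G : 'M[int]_3) (p : 'S_3) :
  perm_eq (colseq R (col_perm p G)) (colseq R G).
Proof.
have colE (A : 'M[int]_3) : colseq R A = [seq gcol R A i | i <- enum 'I_3].
  by rewrite enum_ord3.
have -> : colseq R (col_perm p G) = [seq gcol R G i | i <- [seq p i | i <- enum 'I_3]].
  by rewrite enum_ord3 /=; congr [:: _; _; _]; apply/colP => k; rewrite !mxE.
rewrite colE; apply: perm_map; apply: uniq_perm.
- by rewrite map_inj_uniq ?enum_uniq //; exact: perm_inj.
- exact: enum_uniq.
move=> i; rewrite mem_enum; apply/mapP; exists (p^-1 i)%g; rewrite ?mem_enum //.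
by rewrite permKV.
Qed.

Lemma colseqP (R : realType) (G : 'M[int]_3) u :
  u \in colseq R G -> exists i, u = gcol R G i.
Proof. by rewrite !inE => /or3P[] /eqP->; [exists 0|exists 1|exists 2]. Qed.

Section Run.
Variables (R : realType) (X : 'cV[R]_3).
Hypotheses (X0_gt0 : 0 < X 0 0) (X01 : X 0 0 < X 1 0) (X12 : X 1 0 < X 2 0).
Hypothesis XQ : rationally_independent X.
Variables (G : nat -> 'M[int]_3).
Hypothesis G_run : sva_run X G.

Lemma zc_int_neq0 (h : 'cV[int]_3) : zc X (toR R h) = 0 -> h = 0.
Proof.
move=> /eqP; rewrite mulf_eq0 invr_eq0 (gt_eqF (enormX_gt0 X0_gt0)) orbF => /eqP h0.
apply/colP => i; rewrite mxE; apply/eqP; rewrite -(intr_eq0 rat); apply/eqP.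
apply: (XQ (q := fun i => (h i 0)%:~R)).
by rewrite -[RHS]h0; apply: eq_bigr => j _; rewrite mxE ratr_int.
Qed.

Lemma gcol_toR (A : 'M[int]_3) i : gcol R A i = toR R (col i A).
Proof. by apply/colP => k; rewrite !mxE. Qed.

(** Reduces the three cases of a step to one form; the subtracted column has the smaller index,
    hence the smaller coordinate. *)
Lemma sva_stepP (A A' : 'M[int]_3) : sva_step X A A' ->
  zc X (gcol R A 0) <= zc X (gcol R A 1) <= zc X (gcol R A 2) ->
  exists u v w, [/\ perm_eq (colseq R A) [:: u; v; w],
    perm_eq (colseq R A') [:: u; v - u; w],
    nP X (v - u) <= nP X (w - v), nP X (v - u) <= nP X (w - u) & zc X u <= zc X v].
Proof.
move=> [F [HF [[p ->] _]]] /andP[z01 z12].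
have gapE i j : gapP X A i j = nP X (gcol R A j - gcol R A i) by rewrite /gapP projPB.
have D1 : Delta_min X A <= gapP X A 0 1 by rewrite /Delta_min ge_min lexx.
have D2 : Delta_min X A <= gapP X A 1 2 by rewrite /Delta_min !ge_min lexx orbT.
have D3 : Delta_min X A <= gapP X A 0 2 by rewrite /Delta_min !ge_min lexx !orbT.
rewrite !gapE in D1 D2 D3.
have cs := colseq_perm R F p.
case: HF => -[HD FE]; rewrite HD gapE in D1 D2 D3; rewrite {}FE /colseq !gcol_subcol /= in cs *.
- exists (gcol R A 0), (gcol R A 1), (gcol R A 2).
  by split; [exact: perm_refl|exact: cs|exact: D2|exact: D3|exact: z01].
- exists (gcol R A 1), (gcol R A 2), (gcol R A 0); split.
  + by rewrite (perm_catC [:: _] [:: _; _]).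
  + by apply: (perm_trans cs); rewrite (perm_catC [:: _] [:: _; _]).
  + by rewrite (nP_opp X0_gt0 (gcol R A 0)); exact: D3.
  + by rewrite (nP_opp X0_gt0 (gcol R A 0)); exact: D1.
  + exact: z12.
- exists (gcol R A 0), (gcol R A 2), (gcol R A 1); split.
  + by rewrite perm_cons (perm_catC [:: _] [:: _]).
  + by apply: (perm_trans cs); rewrite perm_cons (perm_catC [:: _] [:: _]).
  + by rewrite (nP_opp X0_gt0 (gcol R A 1)); exact: D2.
  + exact: D1.
  + exact: le_trans z12.
Qed.

Definition goodG (A : 'M[int]_3) := good X (gcol R A 0) (gcol R A 1) (gcol R A 2).

Lemma goodG_perm A u v w : perm_eq (colseq R A) [:: u; v; w] -> goodG A <-> good X u v w.
Proof.
move=> h; split; first exact: good_perm.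
by apply: good_perm; rewrite perm_sym.
Qed.

(** For the identity matrix the areas and the coordinates are all of the form [x_i / |X|], and the
    determinant is [|X|^2 / |X|^2]. *)
Lemma good0 : goodG (G 0).
Proof.
have N0 := enormX_gt0 X0_gt0.
have X1 := lt_trans X0_gt0 X01; have X2 := lt_trans X1 X12.
rewrite /goodG (proj1 G_run); split.
all: rewrite ?/det3 ?(crE X0_gt0) /zc ?dot3E !mxE /=.
all: rewrite ?(mulr0, mul0r, mulr1, mul1r, subr0, sub0r, addr0, add0r, mulrN, mulNr, oppr0, opprK).
- by rewrite mulr_gt0 // divr_gt0.
- by rewrite mulr_gt0 // divr_gt0.
- by rewrite mulr_gt0 // divr_gt0.
- rewrite (_ : _ + _ = 1) ?normr1 //.
  have -> : X 2 0 / enorm X * (X 2 0 / enorm X) + X 0 0 / enorm X * (X 0 0 / enorm X)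
    + X 1 0 / enorm X * (X 1 0 / enorm X) = dot X X / enorm X ^+ 2.
    by rewrite dot3E; field; rewrite gt_eqF.
  by rewrite enorm_sqr divff // -enorm_sqr gt_eqF // exprn_gt0.
- by split; rewrite divr_ge0 // ltW.
Qed.

Lemma sorted0 : zc X (gcol R (G 0) 0) <= zc X (gcol R (G 0) 1) <= zc X (gcol R (G 0) 2).
Proof.
have N0 := enormX_gt0 X0_gt0.
rewrite (proj1 G_run) /zc !dot3E !mxE /=.
rewrite ?(mulr0, mul0r, mulr1, mul1r, subr0, sub0r, addr0, add0r, mulrN, mulNr, oppr0, opprK).
by rewrite !ler_pM2r ?invr_gt0 // !ltW.
Qed.

Lemma goodG_ge0 A : goodG A -> forall i, 0 <= zc X (gcol R A i).
Proof. by move=> [_ _ _ _ [h0 h1 h2]]; apply: forall_ord3. Qed.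

(** A joint induction: the order is needed for [good_step], and nonnegativity turns the order of
    norms into one of coordinates. *)
Lemma good_sorted s : goodG (G s) /\
  zc X (gcol R (G s) 0) <= zc X (gcol R (G s) 1) <= zc X (gcol R (G s) 2).
Proof.
elim: s => [|s [gs zs]]; first by split; [exact: good0|exact: sorted0].
have st := proj2 G_run s.
have gs' : goodG (G s.+1).
  have [u [v [w [p1 p2 _ _ zuv]]]] := sva_stepP st zs.
  by apply/(goodG_perm p2)/good_step => //; apply/(goodG_perm p1).
split => //; have zp := goodG_ge0 gs'.
by case: st => F [_ [_]]; rewrite /sva_sorted !nD_zc // !ger0_norm.
Qed.

Lemma good_neq0 u v w : good X u v w -> [/\ u != 0, v != 0 & w != 0].
Proof.
have cr0 (a : 'cV[R]_3) : cr X 0 a = 0.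
  by rewrite -(subrr a) (crBl X a a a) subrr.
move=> [h1 h2 h3 _ _]; split.
- by apply: contraTneq h1 => ->; rewrite cr0 mul0r ltxx.
- by apply: contraTneq h2 => ->; rewrite cr0 mul0r ltxx.
- by apply: contraTneq h3 => ->; rewrite cr0 mul0r ltxx.
Qed.

(** A zero coordinate of a nonzero integer column would be a rational relation between the entries
    of [X]. *)
Lemma zc_gcol_gt0 s i : 0 < zc X (gcol R (G s) i).
Proof.
have [gs _] := good_sorted s.
rewrite lt_neqAle (goodG_ge0 gs) andbT eq_sym; apply/negP => /eqP.
rewrite gcol_toR => /zc_int_neq0 c0.
have : gcol R (G s) i != 0.
  by move: i {c0}; apply: forall_ord3; case: (good_neq0 gs).
by rewrite gcol_toR c0; case/negP; apply/eqP/colP => k; rewrite !mxE.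
Qed.

Definition zsum (A : 'M[int]_3) : R := zc X (gcol R A 0) + zc X (gcol R A 1) + zc X (gcol R A 2).

Lemma zsum_perm A u v w : perm_eq (colseq R A) [:: u; v; w] ->
  zsum A = zc X u + zc X v + zc X w.
Proof.
move=> h; have : \sum_(x <- colseq R A) zc X x = \sum_(x <- [:: u; v; w]) zc X x.
  exact: perm_big.
by rewrite !big_cons !big_nil !addr0 !addrA.
Qed.

Lemma runP s : exists u v w, [/\ perm_eq (colseq R (G s)) [:: u; v; w],
    perm_eq (colseq R (G s.+1)) [:: u; v - u; w],
    nP X (v - u) <= nP X (w - v) & nP X (v - u) <= nP X (w - u)].
Proof.
have [gs zs] := good_sorted s.
have [u [v [w [p1 p2 n1 n2 zuv]]]] := sva_stepP (proj2 G_run s) zs.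
by exists u, v, w.
Qed.

Lemma zsum_decr s : zsum (G s.+1) < zsum (G s).
Proof.
have [u [v [w [p1 p2 _ _]]]] := runP s.
have /colseqP[i ui] : u \in colseq R (G s) by rewrite (perm_mem p1) mem_head.
have := zc_gcol_gt0 s i; rewrite -ui (zsum_perm p1) (zsum_perm p2) zcB; lra.
Qed.

Lemma zsum_mono s t : (s < t)%N -> zsum (G t) < zsum (G s).
Proof.
elim: t => // t IH; rewrite ltnS leq_eqVlt => /orP[/eqP->|/IH]; first exact: zsum_decr.
exact/lt_trans/zsum_decr.
Qed.

Lemma G_inj : injective G.
Proof.
by move=> s t e; case: (ltngtP s t) => // /zsum_mono; rewrite e ltxx.
Qed.

Definition Mx s : R := max3 (fun i => nP X (gcol R (G s) i)).

Lemma entry_le_enorm (u : 'cV[R]_3) i : `|u i 0| <= enorm u.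
Proof.
apply: abs_le_of_sqr; first exact: enorm_ge0.
rewrite enorm_sqr dot3E; have [[h1 h2] h3] := (sqr_ge0 (u 0 0), sqr_ge0 (u 1 0), sqr_ge0 (u 2 0)).
by move: i; apply: forall_ord3; lra.
Qed.

Lemma zc_le_zsum0 s i : zc X (gcol R (G s) i) <= zsum (G 0).
Proof.
apply: (@le_trans _ _ (zsum (G s))); last first.
  by case: s => // s; apply/ltW/zsum_mono.
have [[h0 h1] h2] := (zc_gcol_gt0 s 0, zc_gcol_gt0 s 1, zc_gcol_gt0 s 2).
by rewrite /zsum; move: i; apply: forall_ord3; lra.
Qed.

(** Coordinates along [X] never exceed [zsum (G 0)], so [Mx s <= B] confines [G s] to a finite set
    of integer matrices, which the injective [G] meets finitely often. *)
Lemma Mx_unbounded (B : R) : exists s0, forall s, (s0 <= s)%N -> B < Mx s.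
Proof.
pose C := `|B| + zsum (G 0); pose N := `|Num.ceil C|%N.
pose S := G @^-1` [set A : 'M[int]_3 | forall i j, `|A i j| <= N%:Z].
have : finite_set S.
  by apply: finite_preimage; [move=> s t _ _; exact: G_inj|exact: finite_bounded_mx].
move=> /finite_nat_bounded[s0 hs0]; exists s0 => s /hs0 nS; rewrite ltNge; apply/negP => MB.
apply: nS => i j /=; rewrite -(ler_int R) intr_norm.
have -> : (G s i j)%:~R = gcol R (G s) j i 0 by rewrite !mxE.
apply: (le_trans (entry_le_enorm _ _)).
have zp := zc_gcol_gt0 s j; have zl := zc_le_zsum0 s j.
have np := nP_ge0 X (gcol R (G s) j).
have nl : nP X (gcol R (G s) j) <= `|B|.
  apply: le_trans (ler_norm _); apply: le_trans MB.
  exact: (le_max3 (fun i => nP X (gcol R (G s) i))).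
have C0 : 0 <= C by rewrite addr_ge0 // (le_trans (ltW zp)).
have : enorm (gcol R (G s) j) <= C.
  apply: le_of_sqr => //; rewrite (enorm_coord X0_gt0).
  apply: (@le_trans _ _ (`|B| ^+ 2 + zsum (G 0) ^+ 2)).
    by rewrite lerD // ler_pXn2r ?nnegrE // ltW // (lt_le_trans zp).
  rewrite /C [leRHS]sqrrD [leRHS]addrAC lerDl mulrn_wge0 // mulr_ge0 //.
  exact: le_trans (ltW zp) zl.
move=> /le_trans; apply; rewrite /N.
have cC : 0 <= Num.ceil C by rewrite -(ler_int R); apply: le_trans (ceil_ge C).
by rewrite gez0_abs //; exact: ceil_ge.
Qed.

End Run.

(** * The polar basis *)

Section Dual.
Variables (R : realType) (X : 'cV[R]_3).
Hypothesis X0_gt0 : 0 < X 0 0.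

(** Cramer's rule: [b] is [v x w] up to sign. Its coordinate along [X] is an area; in the two others
    every term carries a factor [zc v] or [zc w]. *)
Lemma dual_coord_le u v w b (M Z : R) : `|det3 X u v w| = 1 ->
  dot b u = 1 -> dot b v = 0 -> dot b w = 0 ->
  nP X v <= M -> nP X w <= M -> 0 <= zc X v <= Z -> 0 <= zc X w <= Z ->
  nP X b <= 2 * (M * Z) /\ `|zc X b| <= M ^+ 2.
Proof.
move=> d1; rewrite !(dot_coord X0_gt0) => bu bv bw vM wM /andP[zv vZ] /andP[zw wZ].
have d2 : det3 X u v w ^+ 2 = 1 by rewrite -(real_normK (num_real _)) d1 expr1n.
have nPZ a h : 0 <= a -> nP X (a *: h) = a * nP X h.
  move=> a0; apply/eqP; rewrite -(@eqrXn2 _ 2) ?mulr_ge0 ?nP_ge0 //.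
  by rewrite exprMn !(nP_sqr X0_gt0) pcZ qcZ; apply/eqP; ring.
have bz : det3 X u v w * zc X b = cr X v w.
  (* The right side is multiplied by [b.u = 1], and multiples of [b.v = 0] and [b.w = 0] are added,
     leaving a polynomial identity. *)
  rewrite -[RHS]mulr1 -bu.
  rewrite -[RHS]addr0 -(mulr0 (cr X w u)) -bv -[RHS]addr0 -(mulr0 (cr X u v)) -bw.
  by rewrite /det3 /cr; ring.
have bp : det3 X u v w * pc X b = qc X v * zc X w - qc X w * zc X v.
  rewrite -[RHS]mulr1 -bu -[RHS]addr0 -(mulr0 (qc X w * zc X u - qc X u * zc X w)) -bv.
  rewrite -[RHS]addr0 -(mulr0 (qc X u * zc X v - qc X v * zc X u)) -bw.
  by rewrite /det3 /cr; ring.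
have bq : det3 X u v w * qc X b = zc X v * pc X w - zc X w * pc X v.
  rewrite -[RHS]mulr1 -bu -[RHS]addr0 -(mulr0 (zc X w * pc X u - zc X u * pc X w)) -bv.
  rewrite -[RHS]addr0 -(mulr0 (zc X u * pc X v - zc X v * pc X u)) -bw.
  by rewrite /det3 /cr; ring.
split; last first.
  rewrite -[leLHS]mul1r -d1 -normrM bz (le_trans (cr_le X0_gt0 v w)) // expr2.
  by apply: ler_pM => //; exact: nP_ge0.
(* Up to sign, the projection of [b] is that of [zc w v - zc v w] turned by a right angle. *)
have -> : nP X b = nP X (zc X w *: v - zc X v *: w).
  apply/eqP; rewrite -(@eqrXn2 _ 2) ?nP_ge0 // !(nP_sqr X0_gt0) pcB qcB !pcZ !qcZ; apply/eqP.
  rewrite -[LHS]mul1r -d2 mulrDr -!exprMn bp bq; ring.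
apply: (le_trans (nPB_le X0_gt0 _ _)); rewrite !nPZ //.
have e1 : zc X w * nP X v <= Z * M by apply: ler_pM => //; exact: nP_ge0.
have e2 : zc X v * nP X w <= Z * M by apply: ler_pM => //; exact: nP_ge0.
by lra.
Qed.

(** A kernel vector is a linear relation between the columns; by Cramer's rule [det3] times each of
    its coefficients vanishes. *)
Lemma toR_unit (A : 'M[int]_3) : det3 X (gcol R A 0) (gcol R A 1) (gcol R A 2) != 0 ->
  toR R A \in unitmx.
Proof.
set d := det3 _ _ _ _ => d0; rewrite unitmxE unitfE -det_tr; apply/det0P => -[v v0 vA].
have lin : v 0 0 *: gcol R A 0 - (- v 0 1) *: gcol R A 1 - (- v 0 2) *: gcol R A 2 = 0.
  apply/colP => i; move/rowP/(_ i): vA; rewrite !mxE sum_ord3 !mxE => e.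
  by rewrite -[RHS]e; ring.
have pc0 : pc X 0 = 0 by rewrite /pc !mxE; ring.
have qc0 : qc X 0 = 0 by rewrite /qc !mxE; ring.
have zc0 : zc X 0 = 0 by rewrite -(subrr X) zcB subrr.
have := congr1 (zc X) lin; have := congr1 (qc X) lin; have := congr1 (pc X) lin.
rewrite !pcB !qcB !zcB !pcZ !qcZ !zcZ pc0 qc0 zc0.
rewrite /d /det3 /cr in d0; clear d lin vA; move: d0.
move: (gcol R A 0) (gcol R A 1) (gcol R A 2) => g0 g1 g2.
move: (pc X g0) (pc X g1) (pc X g2) (qc X g0) (qc X g1) (qc X g2) (zc X g0) (zc X g1) (zc X g2).
move=> p0 p1 p2 q0 q1 q2 z0 z1 z2; set d := (X in X != 0) => d0 ep eq ez.
have k0 : d * v 0 0 = 0.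
  rewrite -(mulr0 (q1 * z2 - q2 * z1)) -ep -[RHS]addr0 -(mulr0 (z1 * p2 - z2 * p1)) -eq.
  by rewrite -[RHS]addr0 -(mulr0 (p1 * q2 - p2 * q1)) -ez /d; ring.
have k1 : d * v 0 1 = 0.
  rewrite -(mulr0 (q2 * z0 - q0 * z2)) -ep -[RHS]addr0 -(mulr0 (z2 * p0 - z0 * p2)) -eq.
  by rewrite -[RHS]addr0 -(mulr0 (p2 * q0 - p0 * q2)) -ez /d; ring.
have k2 : d * v 0 2 = 0.
  rewrite -(mulr0 (q0 * z1 - q1 * z0)) -ep -[RHS]addr0 -(mulr0 (z0 * p1 - z1 * p0)) -eq.
  by rewrite -[RHS]addr0 -(mulr0 (p0 * q1 - p1 * q0)) -ez /d; ring.
case/eqP: v0; apply/rowP; apply: forall_ord3; rewrite mxE; apply/eqP.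
- by move/eqP: k0; rewrite mulf_eq0 (negPf d0).
- by move/eqP: k1; rewrite mulf_eq0 (negPf d0).
- by move/eqP: k2; rewrite mulf_eq0 (negPf d0).
Qed.

Lemma dot_bcol (A : 'M[int]_3) i j : toR R A \in unitmx ->
  dot (bcol R A i) (gcol R A j) = (i == j)%:R.
Proof.
move=> uA; have := mulVmx uA => /matrixP/(_ i j); rewrite !mxE => <-.
by apply: eq_bigr => k _; rewrite /bcol -trmx_inv !mxE.
Qed.

End Dual.

(** * Thick times *)

Section Conclusion.
Variables (R : realType) (X : 'cV[R]_3).
Hypotheses (X0_gt0 : 0 < X 0 0) (X01 : X 0 0 < X 1 0) (X12 : X 1 0 < X 2 0).
Hypothesis XQ : rationally_independent X.
Variables (G : nat -> 'M[int]_3).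
Hypothesis G_run : sva_run X G.

Let M s : R := mx3 X (gcol R (G s) 0) (gcol R (G s) 1) (gcol R (G s) 2).
Let A s : R := area3 X (gcol R (G s) 0) (gcol R (G s) 1) (gcol R (G s) 2).

Definition thick : set nat := [set s | M s ^+ 2 <= 100 * A s].

(** If all times from [s0] on were flat, the potential would be at most [pot s0] at arbitrarily late
    times; flatness makes it at least [9/10 M^2], so [M] would stay bounded there. *)
Lemma thick_infinite : infinite_set thick.
Proof.
move=> /finite_nat_bounded[s0 flat].
pose pot s := potential X (gcol R (G s) 0) (gcol R (G s) 1) (gcol R (G s) 2).
have step s : (s0 <= s)%N -> exists2 s', (s < s')%N & pot s' <= pot s.
  move=> /flat/negP; rewrite -ltNge => fl.
  have [u [v [w [p1 p2 n1 n2]]]] := runP X0_gt0 X01 X12 G_run s.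
  have [gs _] := good_sorted X0_gt0 X01 X12 G_run s.
  have gd : good X u v w by apply/(goodG_perm X p1).
  have Ms : M s = mx3 X u v w by exact: mx3_perm p1.
  have As : A s = area3 X u v w by exact: area3_perm p1.
  have Ps : pot s = potential X u v w by exact: potential_perm p1.
  rewrite Ms As in fl.
  case: (potential_decreases X0_gt0 gd fl n1 n2) => [le1|le2].
    by exists s.+1 => //; rewrite Ps /pot (potential_perm X p2).
  have [u' [v' [w' [p1' p2' n1' n2']]]] := runP X0_gt0 X01 X12 G_run s.+1.
  have [gs' _] := good_sorted X0_gt0 X01 X12 G_run s.+1.
  have gd' : good X u' v' w' by apply/(goodG_perm X p1').
  exists s.+2; first exact: leqW.
  rewrite Ps /pot (potential_perm X p2'); apply: le2 => //.
  by rewrite perm_sym in p2; exact: perm_trans p2 p1'.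
have iter n : exists2 s, (s0 + n <= s)%N & pot s <= pot s0.
  elim: n => [|n [s sn ps]]; first by exists s0; rewrite ?addn0.
  have [s' ss' ps'] := step s (leq_trans (leq_addr _ _) sn).
  by exists s'; [rewrite addnS (leq_ltn_trans sn)|exact: le_trans ps' ps].
(* The square of this threshold exceeds [10/9 |pot s0|]. *)
have [s1 big] := Mx_unbounded X0_gt0 X01 X12 XQ G_run (1 + 2 * `|pot s0|).
have [s ss ps] := iter s1.
have Mbig : 1 + 2 * `|pot s0| < M s by apply: big; exact: leq_trans (leq_addl _ _) ss.
have /flat/negP : (s0 <= s)%N by exact: leq_trans (leq_addr _ _) ss.
rewrite -ltNge => fl.
have := ler_norm (pot s0); have := normr_ge0 (pot s0).
move: ps; rewrite {1}/pot /potential -/(M s) -/(A s).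
move: (pot s0) `|pot s0| (M s) (A s) Mbig fl => p q m a mq fl pp q0 pq.
have : (1 + 2 * q) * (1 + 2 * q) <= m * m by apply: ler_pM; lra.
have : 0 <= q * q by exact: mulr_ge0.
by rewrite !expr2 in fl pp; lra.
Qed.

Let z s i : R := zc X (gcol R (G s) i).

Lemma z_gt0 s i : 0 < z s i.
Proof. exact (zc_gcol_gt0 X0_gt0 X01 X12 XQ G_run s i). Qed.

Lemma z_sorted s : z s 0 <= z s 1 <= z s 2.
Proof. exact: (good_sorted X0_gt0 X01 X12 G_run s).2. Qed.

Lemma nD_gcol s i : enorm (projD X (gcol R (G s) i)) = z s i.
Proof. by rewrite nD_zc // gtr0_norm // z_gt0. Qed.

Lemma min3_nD s : min3 (fun i => enorm (projD X (gcol R (G s) i))) = z s 0.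
Proof.
have /andP[z01 z12] := z_sorted s.
by rewrite /min3 !nD_gcol (min_l z12) (min_l z01).
Qed.

Lemma max3_nD s : max3 (fun i => enorm (projD X (gcol R (G s) i))) = z s 2.
Proof.
have /andP[z01 z12] := z_sorted s.
by rewrite /max3 !nD_gcol (max_r z12) (max_r (le_trans z01 z12)).
Qed.

(** [z s 0] is the smallest coordinate, so the determinant formula gives [z s 0 * A s <= 1]. *)
Lemma thick_bound s : thick s -> M s ^+ 2 * z s 0 <= 100.
Proof.
move=> th; have [gs zs] := good_sorted X0_gt0 X01 X12 G_run s.
have det := good_det gs; have /andP[z01 z12] := z_sorted s.
have z0 := ltW (z_gt0 s 0).
have e : z s 0 * A s <= 1.
  rewrite -det /A /area3 !mulrDr; apply: lerD; first apply: lerD; rewrite ?lexx //.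
    by rewrite ler_wpM2r //; exact: le_trans z12.
  by rewrite ler_wpM2r.
have := ler_wpM2l z0 th; rewrite mulrC; lra.
Qed.

Lemma M_large (B : R) : exists s0, forall s, (s0 <= s)%N -> B < M s.
Proof. exact (Mx_unbounded X0_gt0 X01 X12 XQ G_run B). Qed.

Lemma cvg0_of_M_bound (f : nat -> R) (S : set nat) (C : R) (s1 : nat) :
  (forall s, (s1 <= s)%N -> S s -> 0 <= f s /\ M s * f s <= C) ->
  f s @[s --> within S \oo] --> (0 : R).
Proof.
move=> h; apply: cvg_within_infty0 => e e0.
have [s0 hs0] := M_large (Num.max 1 (C / e)).
exists (maxn s0 s1) => s; rewrite geq_max => /andP[/hs0 + /h hs] Ss.
have [f0 fC] := hs Ss; rewrite gt_max ltr_pdivrMr // => /andP[M1 Ce].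
rewrite ger0_norm // -(ltr_pM2l (lt_trans ltr01 M1)).
exact: le_lt_trans fC Ce.
Qed.

Lemma M_mul_le s (x C : R) : 0 <= x -> 1 <= M s -> M s ^+ 2 * x <= C -> M s * x <= C.
Proof.
move=> x0 M1; apply: le_trans; rewrite ler_wpM2r // expr2 ler_peMl //; lra.
Qed.

Lemma bad_bound : badly_approximable X ->
  exists C s0, forall s, (s0 <= s)%N -> thick s -> 1 <= M s /\ M s ^+ 2 * z s 2 <= C.
Proof.
move=> /(bad_thick_bound X0_gt0)[C [B H]].
have [s0 hs0] := M_large (Num.max 1 B).
exists C, s0 => s /hs0; rewrite gt_max => /andP[M1 MB] th; split; first exact: ltW.
have [gs zs] := good_sorted X0_gt0 X01 X12 G_run s.
have c0 : col 0 (G s) != 0.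
  apply/eqP => c0; have := z_gt0 s 0; rewrite /z gcol_toR c0 /zc dot3E !mxE.
  by rewrite !mul0r !addr0 mul0r ltxx.
have := H (col 0 (G s)) (col 1 (G s)) (gcol R (G s) 2); cbv zeta; rewrite -!gcol_toR.
by apply => //; exact: ltW.
Qed.

Let nPb s i : R := enorm (projP X (bcol R (G s) i)).
Let nDb s i : R := enorm (projD X (bcol R (G s) i)).

(** Column [i] is brought to the first place by a cyclic rotation, which preserves [det3]. *)
Lemma bcol_bound s i : nPb s i <= 2 * (M s * z s 2) /\ nDb s i <= M s ^+ 2.
Proof.
have [gs _] := good_sorted X0_gt0 X01 X12 G_run s.
have /andP[z01 z12] := z_sorted s.
have d1 : `|det3 X (gcol R (G s) 0) (gcol R (G s) 1) (gcol R (G s) 2)| = 1 by case: gs.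
have u1 : toR R (G s) \in unitmx.
  by apply: (toR_unit (X := X)); rewrite -normr_eq0 d1 oner_eq0.
have [l0 l1 l2] := le_mx3 X (gcol R (G s) 0) (gcol R (G s) 1) (gcol R (G s) 2).
rewrite -/(M s) in l0 l1 l2.
have zb j : 0 <= zc X (gcol R (G s) j) <= z s 2.
  rewrite (ltW (z_gt0 s j)) /=; move: j.
  by apply: forall_ord3; [exact: le_trans z01 z12|exact: z12|exact: lexx].
have bg i' j := @dot_bcol R (G s) i' j u1.
rewrite /nDb nD_zc //; move: i; apply: forall_ord3.
- by apply: (@dual_coord_le _ _ X0_gt0 (gcol R (G s) 0) (gcol R (G s) 1) (gcol R (G s) 2));
    rewrite ?bg.
- apply: (@dual_coord_le _ _ X0_gt0 (gcol R (G s) 1) (gcol R (G s) 2) (gcol R (G s) 0));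
    rewrite ?bg //.
  by rewrite -d1; congr `|_|; rewrite /det3; ring.
- apply: (@dual_coord_le _ _ X0_gt0 (gcol R (G s) 2) (gcol R (G s) 0) (gcol R (G s) 1));
    rewrite ?bg //.
  by rewrite -d1; congr `|_|; rewrite /det3; ring.
Qed.

End Conclusion.

Theorem theorem2 (R : realType) (X : 'cV[R]_3)
  (hX0 : 0 < X 0 0) (hX01 : X 0 0 < X 1 0) (hX12 : X 1 0 < X 2 0)
  (hXQ : rationally_independent X)
  (G : nat -> 'M[int]_3) (hG : sva_run X G) :
  exists S : set nat, infinite_set S /\
  [/\
    (ereal_sup [set ((max3 (fun i => enorm (projP X (gcol R (G s) i)))) ^+ 2
                     * min3 (fun i => enorm (projD X (gcol R (G s) i))))%:E
               | s in S] < +oo)%E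
    /\ min3 (fun i => enorm (projD X (gcol R (G s) i)))
         @[s --> within S \oo] --> (0 : R),
    badly_approximable X ->
    (ereal_sup [set ((max3 (fun i => enorm (projP X (gcol R (G s) i)))) ^+ 2
                     * max3 (fun i => enorm (projD X (gcol R (G s) i))))%:E
               | s in S] < +oo)%E
    /\ max3 (fun i => enorm (projD X (gcol R (G s) i)))
         @[s --> within S \oo] --> (0 : R)
  & badly_approximable X ->
    (ereal_sup [set ((max3 (fun i => enorm (projP X (bcol R (G s) i)))) ^+ 2
                     * max3 (fun i => enorm (projD X (bcol R (G s) i))))%:E
               | s in S] < +oo)%E
    /\ max3 (fun i => enorm (projP X (bcol R (G s) i)))
         @[s --> within S \oo] --> (0 : R)].
Proof.
pose M s := max3 (fun i => nP X (gcol R (G s) i)).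
pose z s i := zc X (gcol R (G s) i).
have M0 s : 0 <= M s by exact: mx3_ge0.
have z0 s i : 0 <= z s i by exact/ltW/(z_gt0 hX0 hX01 hX12 hXQ hG).
have Mlarge := M_large hX0 hX01 hX12 hXQ hG.
have cvg0 := cvg0_of_M_bound hX0 hX01 hX12 hXQ hG.
have mulM := @M_mul_le R X G.
exists (thick X G); split; first exact: thick_infinite.
have minE := min3_nD hX0 hX01 hX12 hXQ hG.
have maxE := max3_nD hX0 hX01 hX12 hXQ hG.
split.
- have bd := thick_bound hX0 hX01 hX12 hXQ hG; split.
    by apply: (@ereal_sup_lt_pinfty _ _ _ 100 0%N) => s _ /bd; rewrite minE.
  have [s1 hs1] := Mlarge 1; apply: (cvg0 _ _ 100 s1) => s /hs1 M1 /bd hs; rewrite minE.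
  by split; [exact: z0|exact: (mulM _ _ _ (z0 s 0) (ltW M1) hs)].
- move=> /(bad_bound hX0 hX01 hX12 hXQ hG)[C [s0 bd]]; split.
    by apply: (@ereal_sup_lt_pinfty _ _ _ C s0) => s ss /(bd s ss)[_]; rewrite maxE.
  apply: (cvg0 _ _ C s0) => s ss /(bd s ss)[M1 hs]; rewrite maxE.
  by split; [exact: z0|exact: (mulM _ _ _ (z0 s 2) M1 hs)].
- move=> /(bad_bound hX0 hX01 hX12 hXQ hG)[C [s0 bd]].
  have bb := bcol_bound hX0 hX01 hX12 hXQ hG.
  have nb s : 0 <= max3 (fun i => enorm (projP X (bcol R (G s) i))) <= 2 * (M s * z s 2).
    apply/andP; split; last first.
      by rewrite max3P; apply/and3P; split; exact: (proj1 (bb s _)).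
    apply: le_trans (le_max3 (fun i => enorm (projP X (bcol R (G s) i))) 0).
    exact: enorm_ge0.
  have db s : 0 <= max3 (fun i => enorm (projD X (bcol R (G s) i))) <= M s ^+ 2.
    apply/andP; split; last first.
      by rewrite max3P; apply/and3P; split; exact: (proj2 (bb s _)).
    apply: le_trans (le_max3 (fun i => enorm (projD X (bcol R (G s) i))) 0).
    exact: enorm_ge0.
  split.
    (* The product is at most [(2 M z_2)^2 M^2 = 4 (M^2 z_2)^2]. *)
    apply: (@ereal_sup_lt_pinfty _ _ _ (4 * C ^+ 2) s0) => s ss /(bd s ss)[M1 hs].
    have [/andP[n0 n1] /andP[d0 d1]] := (nb s, db s).
    apply: (@le_trans _ _ ((2 * (M s * z s 2)) ^+ 2 * M s ^+ 2)).
      by apply: ler_pM; rewrite ?sqr_ge0 // ler_pXn2r ?nnegrE // (le_trans n0).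
    have -> : (2 * (M s * z s 2)) ^+ 2 * M s ^+ 2 = 4 * (M s ^+ 2 * z s 2) ^+ 2 by ring.
    have p0 : 0 <= M s ^+ 2 * z s 2 by rewrite mulr_ge0 ?sqr_ge0 ?z0.
    have hs' : M s ^+ 2 * z s 2 <= C := hs.
    by rewrite ler_pM2l // ler_pXn2r ?nnegrE //; exact: le_trans p0 hs'.
  apply: (cvg0 _ _ (2 * C) s0) => s ss /(bd s ss)[M1 hs].
  have /andP[n0 n1] := nb s; split => //.
  apply: (le_trans (ler_wpM2l (M0 s) n1)).
  have hs' : M s ^+ 2 * z s 2 <= C := hs.
  have -> : M s * (2 * (M s * z s 2)) = 2 * (M s ^+ 2 * z s 2) by ring.
  by rewrite ler_pM2l.
Qed.
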